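(* Let $X$ be a proper Gromov-hyperbolic space with compact boundary, and let $\Gamma$ be a semigroup of isometries of $X$ whose limit set $\Lambda_\Gamma$ contains at least two points. Then the visual dimension of the radial limit set of $\Gamma$ equals the entropy of $\Gamma$: $$\dim_{\mathrm{vis}}(\Lambda^c_\Gamma)=h_\Gamma .$$
   Context: Let $X$ be a metric space with base point $o$. The Gromov product is $(x|y)=\frac12(d(x,o)+d(y,o)-d(x,y))$. $X$ is $\delta$-hyperbolic if $(x|z)\ge\min\{(x|y),(y|z)\}-\delta$ for all $x,y,z\in X$, and Gromov-hyperbolic if it is $\delta$-hyperbolic for some $\delta\ge0$ ($X$ is not assumed geodesic). $X$ is proper if its closed balls are compact. A semigroup of isometries is a subset of $\mathrm{Isom}(X)$ closed under composition. Boundary: a sequence $(x_i)$ in $X$ is convergent if $\lim_{i,j\to\infty}(x_i|x_j)=\infty$. For $A\subseteq X$, $\partial A$ is the set of convergent sequences of $A$ modulo $(x_i)\sim(y_j)$ iff $\lim_{i,j\to\infty}(x_i|y_j)=\infty$. The Gromov product extends to $\overline X=X\cup\partial X$ by $(\xi|\eta)=\sup_{x_i\to\xi,\,y_j\to\eta}\liminf_{i,j\to\infty}(x_i|y_j)$. $\overline X$ has the topology with neighbourhood basis given by the open balls of $X$ and the sets $\{x\in\overline X:(x|\xi)>-\log r\}$, $\xi\in\partial X$. The limit set of $\Gamma$ is $\Lambda_\Gamma=\partial(\Gamma o)$. Radial limit set: a subset $A\subseteq X$ is a sub-quasi-geodesic if there is a constant $C$ with $d(x,y)+d(y,z)\le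 d(x,z)+C$ for all $x,y,z\in A$ such that $\max\{d(x,y),d(y,z)\}\le d(x,z)$. The radial (conical) limit set $\Lambda_\Gamma^c\subseteq\Lambda_\Gamma$ is the set of classes modulo $\sim$ of convergent sequences $(x_i)$ of points of $\Gamma o$ such that $\{x_i\}_{i\in\mathbb N}$ is a sub-quasi-geodesic. Entropy: for $P\subseteq X$, $\delta_P=\limsup_{n\to\infty}\frac1n\log\#(B(o,n)\cap P)$; $S\subseteq X$ is separated if there is $\epsilon>0$ with $d(x,y)>\epsilon$ for all $x\ne y$ in $S$; $h_P=\sup_S\delta_{P\cap S}$ over all separated $S\subseteq X$ ($h_\emptyset=0$), possibly infinite; and $h_\Gamma=h_{\Gamma o}$. Visual dimension: for $\xi\in\partial X$, $r>0$, let $\beta(\xi,r)=\{\eta\in\partial X:(\xi|\eta)>-\log r\}$. For $\Lambda\subseteq\partial X$ and $s\ge 0$, $H^s_\epsilon(\Lambda)$ is the infimum of $\sum_{i\in\mathbb N}r_i^s$ over all coverings $(\beta(\xi_i,r_i))_{i\in\mathbb N}$ of $\Lambda$ with radii $r_i\le\epsilon$; $H^s(\Lambda)=\lim_{\epsilon\to0}H^s_\epsilon(\Lambda)$; $\dim_{\mathrm{vis}}(\Lambda)=\inf\{s\in\mathbb R_+ : H^s(\Lambda)=0\}$. *)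

(* Defs.v *)
From HB Require Import structures.
From mathcomp Require Export all_boot all_order all_algebra.
From mathcomp Require Export all_classical all_reals all_analysis.
Export Order.TTheory GRing.Theory Num.Theory numFieldNormedType.Exports.

Set Implicit Arguments.
Unset Strict Implicit.
Unset Printing Implicit Defensive.

Local Open Scope classical_set_scope.
Local Open Scope ring_scope.

Section GromovHyperbolic.
Context {R : realType} {X : metricType R}.
Implicit Types (o x y z : X) (u v : nat -> X) (A : set X).

(* [closed_ball] of the library is the closure of the open ball, which may be
   smaller than the closed ball of a general metric space. *)
Definition proper_space : Prop :=
  forall x (r : R), compact [set y | mdist x y <= r].

Definition gromov_product o x y : R :=
  (mdist x o + mdist y o - mdist x y) / 2.

Definition hyperbolic_with o (delta : R) : Prop :=
  forall x y z, gromov_product o x z >=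
    Num.min (gromov_product o x y) (gromov_product o y z) - delta.

Definition gromov_hyperbolic o : Prop :=
  exists2 delta : R, 0 <= delta & hyperbolic_with o delta.

(* The limit is along the product filter: both indices tend to infinity,
   independently. *)
Definition asymptotic o u v : Prop :=
  gromov_product o (u p.1) (v p.2) @[p --> (\oo, \oo)] --> +oo.

Definition convergent o u : Prop := asymptotic o u u.

Definition asymptotic_class o u : set (nat -> X) :=
  [set v | convergent o v /\ asymptotic o u v].

(* A boundary point is an equivalence class, represented as a set of
   sequences; [boundary o] is used as a type through the coercion from sets
   to types. When [X] is hyperbolic, [asymptotic o] is an equivalence relation
   on convergent sequences and this is the quotient. *)
Definition boundary o : set (set (nat -> X)) :=
  [set asymptotic_class o u | u in convergent o].

Definition boundary_of o A : set (boundary o) :=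
  [set xi | exists2 u, (forall n, A (u n)) & val xi u].

Definition bordification o : Type := (X + boundary o)%type.

Definition tends_to o u (p : bordification o) : Prop :=
  match p with
  | inl x => u @ \oo --> x
  | inr xi => val xi u
  end.

Definition gromov_product_bar o (p q : bordification o) : \bar R :=
  ereal_sup [set l | exists u v, [/\ tends_to u p, tends_to v q &
    l = limf_einf (fun ij : nat * nat =>
          (gromov_product o (u ij.1) (v ij.2))%:E) (filter_prod \oo \oo)]].

Definition basic_nbhd o (p : bordification o) (r : R) :
    set (bordification o) :=
  match p with
  | inl x => inl @` ball x r
  | inr _ => [set q | ((- ln r)%:E < gromov_product_bar q p)%E]
  end.

(* The sets [basic_nbhd p r] are neighbourhoods of [p] but need not be open
   when [p] is a boundary point. *)
Definition bordification_open o (U : set (bordification o)) : Prop :=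
  forall p, U p -> exists2 r : R, 0 < r & basic_nbhd p r `<=` U.

Lemma basic_nbhdS o (p : bordification o) (r s : R) :
  0 < r -> r <= s -> basic_nbhd p r `<=` basic_nbhd p s.
Proof.
move=> r0 rs; case: p => [x|xi] q /=.
  by move=> [y xy <-]; exists y => //; exact: le_ball xy.
by apply: le_lt_trans; rewrite lee_fin lerN2 ler_ln// posrE (lt_le_trans r0).
Qed.

Lemma bordification_openT o : bordification_open [set: bordification o].
Proof. by move=> p _; exists 1. Qed.

Lemma bordification_openI o : setI_closed (@bordification_open o).
Proof.
move=> U V oU oV p [/oU[r r0 rU] /oV[s s0 sV]].
exists (Num.min r s); first by rewrite lt_min r0.
move=> q pq; split.
  by apply: rU; apply: basic_nbhdS pq; rewrite ?lt_min ?r0// ge_min lexx.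
by apply: sV; apply: basic_nbhdS pq; rewrite ?lt_min ?r0// ge_min lexx orbT.
Qed.

Lemma bordification_open_bigU o (I : Type) (f : I -> set (bordification o)) :
  (forall i, bordification_open (f i)) ->
  bordification_open (\bigcup_i f i).
Proof.
move=> fo p [i _ /fo[r r0 rf]]; exists r => // q /rf fq.
by exists i.
Qed.

HB.instance Definition _ o :=
  Choice.copy (bordification o) (X + boundary o)%type.
HB.instance Definition _ o := isOpenTopological.Build (bordification o)
  (@bordification_openT o) (@bordification_openI o)
  (@bordification_open_bigU o).

Definition boundary_set o : set (bordification o) := range inr.

Definition sub_quasi_geodesic A : Prop :=
  exists C : R, forall x y z, A x -> A y -> A z ->
    Num.max (mdist x y) (mdist y z) <= mdist x z ->
    mdist x y + mdist y z <= mdist x z + C.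

(* [Isom X] is the group of isometries: its elements are bijective. *)
Definition isometry (g : X -> X) : Prop :=
  bijective g /\ forall x y, mdist (g x) (g y) = mdist x y.

Definition isometry_semigroup (Gamma : set (X -> X)) : Prop :=
  (forall g, Gamma g -> isometry g) /\
  (forall g h, Gamma g -> Gamma h -> Gamma (g \o h)).

Definition orbit_of (Gamma : set (X -> X)) o : set X :=
  [set g o | g in Gamma].

Definition limit_set o (Gamma : set (X -> X)) : set (boundary o) :=
  boundary_of (orbit_of Gamma o).

Definition radial_limit_set o (Gamma : set (X -> X)) : set (boundary o) :=
  [set xi | exists u, [/\ forall n, orbit_of Gamma o (u n), val xi u &
                          sub_quasi_geodesic (range u)]].

Definition separated (S : set X) : Prop :=
  exists2 e : R, 0 < e & forall x y, S x -> S y -> x <> y -> e < mdist x y.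

(* The cardinality takes the value +oo on infinite sets, and the logarithm
   satisfies [lne 0 = -oo] and [lne +oo = +oo]. *)
Definition growth_exponent o A : \bar R :=
  limn_esup (fun n : nat =>
    ((n%:R^-1)%:E * lne (counting (ball o n%:R `&` A)))%E).

Definition entropy o A : \bar R :=
  if A == set0 then 0%E
  else ereal_sup [set growth_exponent o (A `&` S) | S in separated].

Definition visual_ball o (xi : boundary o) (r : R) : set (boundary o) :=
  [set eta | ((- ln r)%:E <
    gromov_product_bar (inr xi : bordification o) (inr eta))%E].

Definition visual_premeasure o (s e : R) (L : set (boundary o)) : \bar R :=
  ereal_inf [set t | exists (xi : nat -> boundary o) (r : nat -> R),
    [/\ forall i, (0 < r i <= e)%R,
        L `<=` \bigcup_i visual_ball (xi i) (r i) &
        t = \sum_(0 <= i <oo) (r i `^ s)%:E]]%E.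

Definition visual_measure o (s : R) (L : set (boundary o)) : \bar R :=
  lim (visual_premeasure s e L @[e --> 0^'+]).

Definition visual_dimension o (L : set (boundary o)) : \bar R :=
  ereal_inf [set s%:E | s in [set s : R | 0 <= s /\ visual_measure s L = 0%E]].

End GromovHyperbolic.

Arguments proper_space {R} X.
Arguments boundary_of {R X} o A.
Arguments boundary_set {R X} o.
Arguments limit_set {R X} o Gamma.
Arguments radial_limit_set {R X} o Gamma.

(* Main.v *)
Require Import Defs.
From mathcomp Require Import finmap lra.

Set Implicit Arguments.
Unset Strict Implicit.
Unset Printing Implicit Defensive.

Local Open Scope classical_set_scope.
Local Open Scope ring_scope.

(** The theorem is a Bishop-Jones theorem for semigroups.

Upper bound. Let [S] be a maximal separated subset of the orbit of [o]. A
radial limit point is approached by points [x] of [S] so well that it lies in a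
visual ball attached to [x] of radius about [expR (- |x|)], up to a small
proportion of the exponent, where [|x|] is the distance from [x] to [o]
([radial_agree], [radial_shadow]). For every [s1] above the entropy, the number
of points of [S] with [|x| < n] is at most [expR (s1 * n)] for large [n], so
that the sum of the [s]-th powers of the radii converges for [s] larger than
[s1] ([radial_null]).

Lower bound. Take [t] smaller than the entropy. If [Gamma] contains finitely
many elements [g i], at least [expR (t * M)] of them, of comparable lengths at
most [M], with images of [o] that are far apart and such that the products [g i
\o g j] do not backtrack, then the infinite products [g i1 \o g i2 \o ...] are
quasi-geodesics and code a Cantor set of radial limit points. A visual ball of
radius [r] meets it in a cylinder whose uniform measure is at most a multiple
of [r `^ t], hence its [t]-dimensional visual measure is not zero
([schottky_visual_measure]).

It remains to find such elements ([growth_ample]). Start from a separated part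
of the orbit with growth exponent greater than [t], and from elements [g] that
reach its points. Two distinct boundary points have images under [g] that stay
apart when seen from [g o], so the path from [o] to [g o] is prolonged towards
one of these images, and similarly for [g^-1]. As the boundary is compact, a
part of the family of the same exponent has [g o] close to [u] and [g^-1 o]
close to [v] for some boundary points [u] and [v] ([growth_directions]). The
products [g \o g'] do not backtrack if [u] and [v] are different
([ample_transverse]). If [u] and [v] coincide, choose a long element [f] of
[Gamma] with [f o] away from [u], using a limit point other than [u]. When
[f^-1 o] is also away from [u], the elements [g \o f] have the same images up
to a bounded distance and their inverses no longer point towards [u]
([ample_twist]). When [f^-1 o] points towards [u], the elements [f ^ N \o g],
with [N] depending on [g], have images away from [u] while their inverses still
point towards [u]; they are not longer than [g], and so at least as dense
([ample_shorten]). This last case occurs for instance when [Gamma] fixes the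
boundary point [u]. *)

(** * Gromov products in a metric space *)

Section GromovProduct.
Context {R : realType} {X : metricType R}.
Implicit Types (o p q x y z : X) (g h : X -> X).

Lemma gromov_productC p x y : gromov_product p x y = gromov_product p y x.
Proof. by rewrite /gromov_product (metric_sym x y); lra. Qed.

Lemma gromov_productxx p x : gromov_product p x x = mdist x p.
Proof. by rewrite /gromov_product mdistxx; lra. Qed.

Lemma gromov_product_lel p x y : gromov_product p x y <= mdist x p.
Proof.
rewrite /gromov_product; have := metric_triangle y x p.
by rewrite (metric_sym y x); lra.
Qed.

(** In a tree: the geodesic from [p] to [x] is cut in two pieces by the branch
point of the tripod [p], [x], [y]. *)
Lemma gromov_product_compl p x y :
  gromov_product p x y + gromov_product x p y = mdist x p.
Proof.
rewrite /gromov_product (metric_sym p x) (metric_sym p y) (metric_sym y x).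
by lra.
Qed.

Lemma gromov_product_lip p x y z :
  gromov_product p y z - mdist x y <= gromov_product p x z.
Proof.
rewrite /gromov_product; have := metric_triangle y x p.
by have := metric_triangle x y z; rewrite (metric_sym y x); lra.
Qed.

Lemma gromov_product_base p q x y :
  gromov_product p x y <= mdist p q + gromov_product q x y.
Proof.
rewrite /gromov_product; have := metric_triangle x q p.
have := metric_triangle y q p.
by rewrite (metric_sym q p); lra.
Qed.

Definition preserves_mdist g := forall x y, mdist (g x) (g y) = mdist x y.

Lemma gromov_product_iso g p x y : preserves_mdist g ->
  gromov_product (g p) (g x) (g y) = gromov_product p x y.
Proof. by move=> gd; rewrite /gromov_product !gd. Qed.

Lemma gromov_product_basel p x : gromov_product p p x = 0.
Proof. by rewrite /gromov_product mdistxx (metric_sym p x); lra. Qed.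

Lemma isometry_id : isometry (@id X).
Proof. by split; first exists id. Qed.

Lemma isometry_comp g h : isometry g -> isometry h -> isometry (g \o h).
Proof.
move=> [gb gd] [hb hd]; split; first exact: bij_comp.
by move=> x y /=; rewrite gd hd.
Qed.

Lemma isometry_inv g : isometry g ->
  exists h, [/\ preserves_mdist h, cancel g h & cancel h g].
Proof.
move=> [[h gK hK] gd]; exists h; split=> // x y.
by rewrite -gd !hK.
Qed.

Lemma hyperbolic_with_iso g p delta : isometry g ->
  hyperbolic_with p delta -> hyperbolic_with (g p) delta.
Proof.
move=> [[h gK hK] gd] hyp x y z.
by rewrite -[x]hK -[y]hK -[z]hK !gromov_product_iso.
Qed.

Lemma hyperbolic_le p delta c x y z : hyperbolic_with p delta ->
  c <= gromov_product p x y -> c <= gromov_product p y z ->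
  c - delta <= gromov_product p x z.
Proof.
move=> hyp xy yz; apply: le_trans (hyp x y z).
by rewrite lerD2r le_min xy.
Qed.

Lemma hyperbolic_lt p delta c x y z : hyperbolic_with p delta ->
  c < gromov_product p x y -> c < gromov_product p y z ->
  c - delta < gromov_product p x z.
Proof.
move=> hyp xy yz; apply: lt_le_trans (hyp x y z).
by rewrite ltrD2r lt_min xy.
Qed.

(** In a tree: if [z] leaves the path to [x] before the distance [c], it leaves at
the same place the path to any [y] that follows [x] beyond [c]. *)
Lemma hyperbolic_branch p delta c x y z : hyperbolic_with p delta ->
  gromov_product p x z <= c -> c + delta < gromov_product p x y ->
  gromov_product p y z <= c + delta.
Proof.
move=> hyp xz xy; rewrite leNgt; apply/negP => yz.
have := hyperbolic_lt hyp xy yz; lra.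
Qed.

End GromovProduct.

(** * Sequences and boundary points *)

Section Agreement.
Context {R : realType} {X : metricType R} (o : X).
Implicit Types (x y z : X) (u v w : nat -> X) (g h : X -> X) (c : R).

(** Sequences stand for boundary points, and constant sequences for points of
the space, so this single relation compares all kinds of points. *)
Definition agree u v c := exists N, forall i j, (N <= i)%N -> (N <= j)%N ->
  c < gromov_product o (u i) (v j).

Lemma agree_le u v c c' : c' <= c -> agree u v c -> agree u v c'.
Proof.
by move=> cc' [N H]; exists N => i j Ni Nj; apply: le_lt_trans cc' (H _ _ Ni Nj).
Qed.

Lemma agreeC u v c : agree u v c -> agree v u c.
Proof.
by move=> [N H]; exists N => i j Ni Nj; rewrite gromov_productC; exact: H.
Qed.

Lemma asymptoticP u v : asymptotic o u v <-> forall c, agree u v c.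
Proof.
rewrite /asymptotic; split=> [uv c|uv].
  have /cvgryPgt /(_ c) := uv.
  move=> [[A B] [/= [n _ An] [m _ Bm]] AB].
  exists (maxn n m) => i j; rewrite !geq_max => /andP[ni _] /andP[_ mj].
  exact: (AB (i, j) (conj (An _ ni) (Bm _ mj))).
apply/cvgryPgt => c; have [N HN] := uv c.
exists ([set i | (N <= i)%N], [set i | (N <= i)%N]) => /=.
  by split; exists N.
by move=> [i j] [/= Ni Nj]; exact: HN.
Qed.

Lemma convergent_dist u c : convergent o u ->
  exists N, forall i, (N <= i)%N -> c < mdist (u i) o.
Proof.
move=> /asymptoticP/(_ c)[N HN]; exists N => i Ni.
by rewrite -gromov_productxx; exact: HN.
Qed.

Lemma convergent_iso g u : preserves_mdist g -> convergent o u ->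
  convergent o (g \o u).
Proof.
move=> gd /asymptoticP cu; apply/asymptoticP => c.
have [N HN] := cu (c + mdist (g o) o); exists N => i j Ni Nj /=.
have := HN _ _ Ni Nj; rewrite -(gromov_product_iso _ _ _ gd).
have := gromov_product_base (g o) o (g (u i)) (g (u j)); lra.
Qed.

Context {delta : R} (hyp : hyperbolic_with o delta).

Lemma agree_trans u v w c : agree u v c -> agree v w c -> agree u w (c - delta).
Proof.
move=> [N HN] [M HM]; exists (maxn N M) => i j.
rewrite !geq_max => /andP[Ni Mi] /andP[Nj Mj].
exact: hyperbolic_lt hyp (HN _ _ Ni Ni) (HM _ _ Mi Mj).
Qed.

Lemma asymptotic_trans u v w :
  asymptotic o u v -> asymptotic o v w -> asymptotic o u w.
Proof.
move=> /asymptoticP uv /asymptoticP vw; apply/asymptoticP => c.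
by rewrite -(addrK delta c); apply: agree_trans.
Qed.

Lemma asymptotic_sym u v : asymptotic o u v -> asymptotic o v u.
Proof.
by move=> /asymptoticP uv; apply/asymptoticP => c; exact: agreeC.
Qed.

(** The transition between agreement and disagreement is sharp up to a multiple
of [delta] because both sequences converge: if the Gromov products do not all
exceed [c] in the end, then in the end none exceeds [c + 2 * delta]. *)
Lemma disagree u v c : convergent o u -> convergent o v -> ~ agree u v c ->
  exists N, forall i j, (N <= i)%N -> (N <= j)%N ->
    gromov_product o (u i) (v j) <= c + 2 * delta.
Proof.
move=> /asymptoticP cu /asymptoticP cv uv.
have [N HN] := cu (c + 2 * delta); have [M HM] := cv (c + 2 * delta).
exists (maxn N M) => i j; rewrite !geq_max => /andP[Ni Mi] /andP[Nj Mj].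
rewrite leNgt; apply/negP => ij; apply: uv.
exists (maxn N M) => i' j'; rewrite !geq_max => /andP[Ni' Mi'] /andP[Nj' Mj'].
have := hyperbolic_lt hyp (HN _ _ Ni' Ni) ij => i'j.
have Mj'' : c + 2 * delta - delta < gromov_product o (v j) (v j').
  (* hyperbolicity for three equal points excludes a negative [delta] *)
  have [d0|d0] := lerP 0 delta; first by have := HM _ _ Mj Mj'; lra.
  have := hyp o o o; rewrite minxx; lra.
have := hyperbolic_lt hyp i'j Mj''; lra.
Qed.

Implicit Types (xi eta : boundary o).

Lemma boundary_convergent xi u : val xi u -> convergent o u.
Proof. by case: xi => s /= /set_mem[v cv <-] []. Qed.

Lemma boundary_asymptotic xi u v : val xi u -> val xi v -> asymptotic o u v.
Proof.
case: xi => s /= /set_mem[w cw <-] [_ wu] [_ wv].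
exact: asymptotic_trans (asymptotic_sym wu) wv.
Qed.

Lemma boundary_mem xi u v : val xi u -> convergent o v ->
  asymptotic o u v -> val xi v.
Proof.
case: xi => s /= /set_mem[w cw <-] [_ wu] cv uv; split=> //.
exact: asymptotic_trans wu uv.
Qed.

Lemma boundary_eq xi eta u v : val xi u -> val eta v -> asymptotic o u v ->
  xi = eta.
Proof.
move=> xu ev uv; apply: val_inj; apply/seteqP; split=> w Hw.
- apply: (boundary_mem ev); first exact: boundary_convergent Hw.
  exact: asymptotic_trans (asymptotic_sym uv) (boundary_asymptotic xu Hw).
- apply: (boundary_mem xu); first exact: boundary_convergent Hw.
  exact: asymptotic_trans uv (boundary_asymptotic ev Hw).
Qed.

Lemma boundary_inh xi : exists u, val xi u.
Proof.
case: xi => s /=; move/[dup]/set_mem => -[w cw <-] _.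
by exists w; split.
Qed.

Lemma boundary_class u : convergent o u -> exists xi, val xi u.
Proof.
move=> cu; exists (SigSub (mem_set (imageP (asymptotic_class o) cu))) => /=.
by split.
Qed.

Lemma gromov_product_bar_ge xi eta u v c : val xi u -> val eta v ->
  agree u v c ->
  (c%:E <= gromov_product_bar (inr xi : bordification o) (inr eta))%E.
Proof.
move=> xu ev [N HN].
apply: (@le_trans _ _ (limf_einf (fun ij : nat * nat =>
          (gromov_product o (u ij.1) (v ij.2))%:E) (filter_prod \oo \oo))).
  rewrite limf_einfE; apply: le_trans; last first.
    apply: ereal_sup_ubound.
    exists ([set i | (N <= i)%N] `*` [set i | (N <= i)%N]); last by [].
    exists ([set i | (N <= i)%N], [set i | (N <= i)%N]) => //=.
    by split; exists N.
  apply: le_ereal_inf_tmp => _ [[i j] [/= Ni Nj] <-].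
  by rewrite lee_fin ltW//; exact: HN.
by apply: ereal_sup_ubound; exists u, v.
Qed.

Lemma gromov_product_bar_gt xi eta u v c : val xi u -> val eta v ->
  (c%:E < gromov_product_bar (inr xi : bordification o) (inr eta))%E ->
  agree u v (c - 2 * delta).
Proof.
move=> xu ev /ereal_sup_gt[_ [u' [v' [/= xu' ev' ->]]]].
rewrite limf_einfE => /ereal_sup_gt[_ [V [[A B] /= [[n _ An] [m _ Bm]] AB] <-]].
move=> cV; have uv' : agree u' v' c.
  exists (maxn n m) => i j; rewrite !geq_max => /andP[ni _] /andP[_ mj].
  rewrite -lte_fin; apply: lt_le_trans cV _; apply: ereal_inf_lbound.
  by exists (i, j) => //; apply: AB; split => /=; [exact: An|exact: Bm].
have /asymptoticP uu := boundary_asymptotic xu xu'.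
have /asymptoticP vv := boundary_asymptotic ev' ev.
have := agree_trans (uu c) uv' => /agree_trans/(_ (vv _)).
by apply: agree_le; lra.
Qed.

End Agreement.

(** * Accumulation at a compact boundary *)

Section Compactness.
Context {R : realType} {X : metricType R} (o : X) (delta : R).
Hypothesis hyp : hyperbolic_with o delta.

(** The visual neighbourhoods of a boundary point are neighbourhoods for the
topology of the bordification.  An open set between the two is made of
all the points of the space and of the boundary points that have a visual ball
contained in the neighbourhood. *)
Lemma nbhs_agree (xi : boundary o) u c : val xi u ->
  nbhs (inr xi : bordification o)
    [set q | forall eta : boundary o, q = inr eta ->
      forall v, val eta v -> agree o u v c].
Proof.
move=> xu.
pose near_bd b (zeta eta : boundary o) :=
  (b%:E < gromov_product_bar (inr zeta : bordification o) (inr eta))%E.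
pose U : set (bordification o) := fun q => match q with
  | inl _ => True
  | inr eta => exists b, forall zeta, near_bd b zeta eta ->
      forall v, val zeta v -> agree o u v c
  end.
rewrite nbhsE; exists U; last first.
  move=> q Uq eta qE v ev; move: Uq; rewrite qE => -[b Hb].
  apply: (Hb eta) => //.
  rewrite /near_bd; apply: (@lt_le_trans _ _ (b + 1)%:E).
    by rewrite lte_fin; lra.
  apply: (gromov_product_bar_ge ev ev).
  by have /asymptoticP := boundary_convergent ev; apply.
split; last first.
  exists (c + 2 * delta) => zeta zx v zv; apply: agreeC.
  by apply: agree_le (gromov_product_bar_gt hyp zv xu zx); lra.
move=> [x|eta]; first by exists 1 => // _ [y _ <-].
move=> [b Hb]; exists (expR (- (b + 4 * `|delta| + 1))); first exact: expR_gt0.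
move=> [//|zeta] /=; rewrite expRK opprK => zeta_eta.
exists (b + 4 * `|delta| + 1) => theta theta_zeta; apply: Hb.
have [t tT] := boundary_inh theta; have [z zZ] := boundary_inh zeta.
have [w wE] := boundary_inh eta.
have := agree_trans hyp (gromov_product_bar_gt hyp tT zZ theta_zeta)
  (gromov_product_bar_gt hyp zZ wE zeta_eta).
move=> /(gromov_product_bar_ge tT wE); apply: lt_le_trans.
by rewrite lte_fin; have := ler_norm delta; have := normr_ge0 delta; lra.
Qed.

(** [J] is an ideal of negligible index sets.  The complements of negligible sets
form a filter; its image under a choice of boundary points close to the [f i]
has a cluster point by compactness, and the non-negligible families near this
cluster point are those of the conclusion. *)
Lemma agree_accumulation (I : Type) (J : set (set I)) (P : set I)
    (f : I -> X) (K : R) :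
  compact (boundary_set o) ->
  (forall A B, A `<=` B -> J B -> J A) ->
  (forall A B, J A -> J B -> J (A `|` B)) ->
  ~ J P ->
  (forall L, J [set i | P i /\ mdist (f i) o <= L]) ->
  (forall i, P i -> exists v, convergent o v /\
     agree o (fun=> f i) v (mdist (f i) o - K)) ->
  exists u, convergent o u /\
    forall c, ~ J [set i | P i /\ agree o (fun=> f i) u c].
Proof.
move=> cpt JS JU nJP JL near_bd.
have [i0 Pi0] : exists i, P i.
  apply: contrapT => nP; apply: nJP; apply: JS (JL 0) => i Pi.
  by case: nP; exists i.
have [zeta0 _] : exists zeta : boundary o, True.
  by have [v [cv _]] := near_bd _ Pi0; have [z _] := boundary_class cv; exists z.
have : forall i, exists zeta : boundary o, P i ->
    exists2 v, val zeta v & agree o (fun=> f i) v (mdist (f i) o - K).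
  move=> i; case: (pselect (P i)) => [Pi|nPi]; last by exists zeta0.
  have [v [cv vK]] := near_bd _ Pi; have [z zv] := boundary_class cv.
  by exists z => _; exists v.
move=> /choice[zeta zetaP].
pose F : set_system (bordification o) :=
  [set A | J [set i | P i /\ ~ A (inr (zeta i))]].
have J0 : J set0 by apply: JS (JL 0).
have PF : ProperFilter F.
  apply: Build_ProperFilter_ex.
    move=> A FA; apply: contrapT => nA; apply: nJP.
    by apply: JS FA => i Pi; split=> // Ai; apply: nA; exists (inr (zeta i)).
  split.
  - by apply: JS J0 => i [_]; apply.
  - move=> A B FA FB; apply: JS (JU _ _ FA FB) => i [Pi /not_andP[nA|nB]].
      by left.
    by right.
  - by move=> A B AB; apply: JS => i [Pi nB]; split=> // /AB.
have FB : F (boundary_set o).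
  by apply: JS J0 => i [_]; apply; exists (zeta i).
have [_ [[alpha _ <-] cl]] := cpt F PF FB.
have [u au] := boundary_inh alpha.
exists u; split; first exact: boundary_convergent au.
move=> c Jc.
pose bad := [set i | P i /\ mdist (f i) o <= c + `|delta| + K].
pose A : set (bordification o) :=
  [set q | exists i, [/\ P i, ~ bad i, ~ agree o (fun=> f i) u c &
                         q = inr (zeta i)]].
have FA : F A.
  apply: JS (JU _ _ Jc (JL (c + `|delta| + K))) => i [Pi nA].
  have [ag|nag] := pselect (agree o (fun=> f i) u c); first by left.
  have [b|nb] := pselect (bad i); first by right.
  by case: nA; exists i.
have [_ [[i [Pi nb nag ->]] /(_ _ erefl) H]] :=
  cl _ _ FA (nbhs_agree (c + `|delta|) au).
have [v zv fv] := zetaP _ Pi.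
apply: nag; have ag := agreeC (H v zv).
have fv' : agree o (fun=> f i) v (c + `|delta|).
  apply: agree_le fv; have : ~ (mdist (f i) o <= c + `|delta| + K).
    by move=> ?; apply: nb.
  by move=> /negP; rewrite -ltNge; lra.
have := agree_trans hyp fv' ag; apply: agree_le.
have := ler_norm delta; lra.
Qed.

(** Two distinct boundary points are seen from any [g o] under the same bounded
Gromov product as from [o], so the segment from [o] to [g o] is prolonged
by the ray to the image of one of them. *)
Lemma isometry_near_boundary u v :
  convergent o u -> convergent o v -> ~ asymptotic o u v ->
  exists K, forall g, isometry g -> exists w, convergent o w /\
    agree o (fun=> g o) w (mdist (g o) o - K).
Proof.
move=> cu cv /asymptoticP/existsNP[c nuv].
have [N HN] := disagree hyp cu cv nuv.
pose T := c + 2 * delta; exists (T + delta + 1) => g ig.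
have gd : preserves_mdist g by case: ig.
have hypg := hyperbolic_with_iso ig hyp.
have close x : gromov_product (g o) o x <= T + delta ->
    mdist (g o) o - (T + delta + 1) < gromov_product o (g o) x.
  have := gromov_product_compl o (g o) x; lra.
have [Hu|/existsNP[i /not_implyP[Ni]]] := pselect (forall i, (N <= i)%N ->
    gromov_product (g o) o (g (u i)) <= T + delta).
  exists (g \o u); split; first exact: convergent_iso.
  by exists N => _ i _ Ni /=; apply: close; apply: Hu.
move=> /negP; rewrite -ltNge => gi.
exists (g \o v); split; first exact: convergent_iso.
exists N => _ j _ Nj /=; apply: close.
apply: hyperbolic_branch hypg _ (_ : _ < gromov_product (g o) (g (u i)) o).
  by rewrite gromov_product_iso//; apply: HN.
by rewrite gromov_productC.
Qed.

End Compactness.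

(** * Infinite words avoiding a small family of cylinders *)

Section Cylinders.
Context {R : realType} {I : finType}.
Implicit Types (s p : seq I).

Let a : R := #|I|%:R^-1.

(** The uniform measure of the intersection of the cylinders of the infinite
words starting with [s], respectively with [p]. *)
Fixpoint cylinder_mass s p : R := match s, p with
  | [::], _ => a ^+ size p
  | _ :: s', [::] => a ^+ size s
  | x :: s', y :: p' => if x == y then a * cylinder_mass s' p' else 0
  end.

Lemma cylinder_mass_ge0 s p : 0 <= cylinder_mass s p.
Proof.
have a0 : 0 <= a by rewrite invr_ge0.
elim: s p => [|x s IH] [|y p] /=; rewrite ?exprn_ge0//.
by case: ifP => // _; rewrite mulr_ge0.
Qed.

Lemma cylinder_massnil s : cylinder_mass s [::] = a ^+ size s.
Proof. by case: s. Qed.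

Lemma cylinder_massxx s : cylinder_mass s s = a ^+ size s.
Proof. by elim: s => //= x s ->; rewrite eqxx exprS. Qed.

Lemma cylinder_mass_rcons (x0 : I) s p :
  \sum_(x : I) cylinder_mass s (rcons p x) = cylinder_mass s p.
Proof.
have I0 : #|I|%:R != 0 :> R by rewrite pnatr_eq0 -lt0n; apply/card_gt0P; exists x0.
elim: s p => [|y s IH] [|z p] /=.
- by rewrite sumr_const expr1 expr0 -mulr_natr mulVf.
- under eq_bigr do rewrite size_rcons.
  by rewrite sumr_const [in LHS]exprS -mulr_natr mulrAC mulVf ?mul1r.
- rewrite (bigD1 y)//= eqxx big1 ?addr0 ?cylinder_massnil ?exprS//.
  by move=> x; rewrite eq_sym => /negbTE ->.
- by case: ifP => _; [rewrite -mulr_sumr IH|rewrite big1].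
Qed.

(** The infinite word is built letter by letter, keeping the total mass of the
cylinders inside the current cylinder smaller than the mass of the latter: this
is possible because both masses are the sums of the masses over the one-letter
extensions. *)
Lemma avoid_cylinders (c : nat -> nat -> I) (K : nat -> nat) :
  (\sum_(0 <= i <oo) (a ^+ K i)%:E < 1)%E ->
  exists w : nat -> I, forall i, exists2 k, (k < K i)%N & w k <> c i k.
Proof.
move=> sum1; pose s i := mkseq (c i) (K i).
pose x0 := c 0 0.
have I0 : 0 < #|I|%:R :> R.
  by rewrite ltr0n; apply/card_gt0P; exists x0.
pose W p : \bar R := (\sum_(0 <= i <oo) (cylinder_mass (s i) p)%:E)%E.
have step p : exists x, (W p < (a ^+ size p)%:E)%E ->
    (W (rcons p x) < (a ^+ size (rcons p x))%:E)%E.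
  have [Wp|nWp] := pselect (W p < (a ^+ size p)%:E)%E; last first.
    by exists x0.
  apply: contrapT => /forallNP big; suff : ((a ^+ size p)%:E <= W p)%E.
    by rewrite leNgt Wp.
  rewrite /W; under eq_eseriesr do rewrite -(cylinder_mass_rcons x0) -sumEFin.
  rewrite nneseries_sum; last by move=> *; rewrite lee_fin cylinder_mass_ge0.
  have -> : (a ^+ size p)%:E = (\sum_(x : I) (a ^+ (size p).+1)%:E)%E.
    rewrite sumEFin sumr_const -mulr_natr exprS mulrAC mulVf ?mul1r//.
    by rewrite gt_eqF.
  apply: lee_sum => x _; have /not_implyP[_ /negP] := big x.
  by rewrite -leNgt size_rcons.
have [next nextP] := choice step.
pose pre n := iter n (fun p => rcons p (next p)) [::].
pose w n := next (pre n).
have preE n : pre n = mkseq w n.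
  by elim: n => //= n IH; rewrite {1}IH -mkseqS.
have Wpre n : (W (pre n) < (a ^+ n)%:E)%E.
  elim: n => [|n IH].
    rewrite expr0 /W; under eq_eseriesr do rewrite cylinder_massnil size_mkseq.
    exact: sum1.
  have := @nextP (pre n); rewrite size_rcons [in size _]preE size_mkseq.
  by apply.
exists w => i; apply: contrapT => nk.
have wc : pre (K i) = s i.
  rewrite preE; apply/eq_in_map => k; rewrite mem_iota add0n => /= kK.
  by apply: contrapT => wck; apply: nk; exists k.
have := Wpre (K i); rewrite ltNge => /negP; apply.
apply: le_trans (nneseries_lim_ge i.+1 _); last first.
  by move=> *; rewrite lee_fin cylinder_mass_ge0.
rewrite big_nat_recr//= wc cylinder_massxx size_mkseq leeDr//.
by apply: sume_ge0 => *; rewrite lee_fin cylinder_mass_ge0.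
Qed.

End Cylinders.

(** * Schottky families *)

Section Schottky.
Context {R : realType} {X : metricType R} (o : X) (delta : R).
Hypotheses (delta0 : 0 <= delta) (hyp : hyperbolic_with o delta).
Context {I : finType} (g : I -> X -> X) (m M T : R).

(** The isometries of a Schottky family move the base point far compared with
the error terms; products do not backtrack ([schottky_turn]) and the images of
the base point branch off early from each other ([schottky_fork]): before the
length [m - T - delta] up to which a product follows its first factor, with a
margin for two applications of hyperbolicity. *)
Record schottky : Prop := Schottky {
  schottky_iso : forall i, isometry (g i);
  schottky_ge : forall i, m <= mdist (g i o) o;
  schottky_le : forall i, mdist (g i o) o <= M;
  schottky_turn : forall i j, gromov_product (g i o) o (g i (g j o)) <= T;
  schottky_fork : forall i j, i != j ->
    gromov_product o (g i o) (g j o) < m - T - 3 * delta;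
  schottky_large : 2 * T + 3 * delta < m }.

Hypotheses (S : schottky) (T0 : 0 <= T).
Implicit Types (w v : nat -> I) (n i j k : nat).

(** The product of the first [n] letters, the first letter being applied last. *)
Fixpoint word w n : X -> X :=
  if n is n'.+1 then word w n' \o g (w n') else id.

Definition pos w n : X := word w n o.

Definition shift w k : nat -> I := fun n => w (k + n)%N.

Lemma word_iso w n : isometry (word w n).
Proof.
elim: n => [|n IH]; first exact: isometry_id.
exact: isometry_comp IH (schottky_iso S _).
Qed.

Lemma wordD w k n : word w (k + n) = word w k \o word (shift w k) n.
Proof.
elim: n => [|n IH]; first by rewrite addn0.
by rewrite addnS /= IH.
Qed.

Lemma word_mdist w n : preserves_mdist (word w n).
Proof. by case: (word_iso w n). Qed.

Lemma posD w k n : pos w (k + n) = word w k (pos (shift w k) n).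
Proof. by rewrite /pos wordD. Qed.

Lemma hyp_pos w n : hyperbolic_with (pos w n) delta.
Proof. exact: hyperbolic_with_iso (word_iso w n) hyp. Qed.

Lemma gromov_product_shift w k (a b c : nat) :
  gromov_product (pos w (k + a)) (pos w (k + b)) (pos w (k + c)) =
  gromov_product (pos (shift w k) a) (pos (shift w k) b) (pos (shift w k) c).
Proof. by rewrite !posD gromov_product_iso//; exact: word_mdist. Qed.

Lemma mdist_step w k : mdist (pos w k.+1) (pos w k) = mdist (g (w k) o) o.
Proof. by rewrite /pos /= word_mdist. Qed.

Lemma turn w k : gromov_product (pos w k.+1) (pos w k) (pos w k.+2) <= T.
Proof.
have := gromov_product_shift w k 1 0 2; rewrite addn1 addn0 addn2 => ->.
exact: schottky_turn S _ _.
Qed.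

(** Local non-backtracking is global: induction on the number of steps, the
step being so long that the error [T + delta] cannot propagate. *)
Lemma turn_forward w n : gromov_product (pos w 1) o (pos w n.+1) <= T + delta.
Proof.
have d0 := delta0; have t0 := T0.
elim: n w => [|n IH] w.
  by rewrite gromov_productC gromov_product_basel addr_ge0.
have t := turn w 0; have L := schottky_large S.
case: n IH => [_|n IH]; first by apply: le_trans t _; rewrite lerDl.
rewrite gromov_productC; apply: (hyperbolic_branch (@hyp_pos w 1)) (_ : _ <
  gromov_product (pos w 1) (pos w 2) (pos w n.+3)).
  by rewrite gromov_productC; exact: t.
have := gromov_product_compl (pos w 1) (pos w 2) (pos w n.+3).
have := gromov_product_shift w 1 1 0 n.+2; have := IH (shift w 1).
rewrite addn0 !add1n mdist_step => + ->.
have := schottky_ge S (w 1%N); have : pos (shift w 1) 0 = o by [].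
by move=> ->; lra.
Qed.

(** The same induction, on the other side of the turn. *)
Lemma turn_backward w k : gromov_product (pos w k) o (pos w k.+1) <= T + delta.
Proof.
have d0 := delta0; have t0 := T0.
elim: k => [|k IH]; first by rewrite gromov_product_basel addr_ge0.
have t := turn w k; have L := schottky_large S.
apply: (hyperbolic_branch (@hyp_pos w k.+1) t).
have := gromov_product_compl (pos w k.+1) (pos w k) o.
rewrite (gromov_productC (pos w k)) metric_sym mdist_step.
by have := schottky_ge S (w k); lra.
Qed.

Lemma turn_all0 w k n : gromov_product (pos w k) o (pos w (k + n)) <= T + 2 * delta.
Proof.
have d0 := delta0; have t0 := T0.
case: n => [|n].
  by rewrite addn0 gromov_productC gromov_product_basel; lra.
have := turn_backward w k; rewrite gromov_productC => tb.
have L := schottky_large S.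
have : T + delta + delta <
    gromov_product (pos w k) (pos w k.+1) (pos w (k + n.+1)).
  have := gromov_product_shift w k 0 1 n.+1; rewrite addn0 addn1 => ->.
  have := gromov_product_compl (pos (shift w k) 0) (pos (shift w k) 1)
    (pos (shift w k) n.+1).
  rewrite mdist_step; have := turn_forward (shift w k) n.
  by have := schottky_ge S (shift w k 0%N); rewrite {3}/pos /=; lra.
move=> /(hyperbolic_branch (@hyp_pos w k) tb); rewrite gromov_productC; lra.
Qed.

Lemma turn_all w i k j : (i <= k)%N -> (k <= j)%N ->
  gromov_product (pos w k) (pos w i) (pos w j) <= T + 2 * delta.
Proof.
have d0 := delta0; have t0 := T0.
move=> ik kj; have := gromov_product_shift w i (k - i) 0 (j - i).
rewrite addn0 !subnKC// ?(leq_trans ik)// => ->.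
rewrite (_ : j - i = (k - i) + (j - k))%N; first exact: turn_all0.
by rewrite addnC addnBA// subnK.
Qed.

Lemma pos_quasigeodesic w i k j : (i <= k)%N -> (k <= j)%N ->
  mdist (pos w i) (pos w k) + mdist (pos w k) (pos w j) <=
  mdist (pos w i) (pos w j) + 2 * (T + 2 * delta).
Proof.
have d0 := delta0; have t0 := T0.
move=> ik kj; have := turn_all w ik kj.
rewrite /gromov_product (metric_sym (pos w j) (pos w k)); lra.
Qed.

(** The sequence starts after the first letter because the base point need not
belong to the orbit of the semigroup. *)
Lemma pos_sub_quasi_geodesic w : sub_quasi_geodesic (range (pos w \o succn)).
Proof.
have d0 := delta0; have t0 := T0.
pose C := 2 * (T + 2 * delta); have C0 : 0 <= C by rewrite /C; lra.
exists (2 * C) => _ _ _ [i _ <-] [k _ <-] [j _ <-] /=.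
rewrite ge_max => /andP[].
move: i.+1 k.+1 j.+1 => {}i {}k {}j.
(* by symmetry the first point comes before the last one *)
wlog ij : i j / (i <= j)%N.
  move=> H dik dkj; case: (leqP i j) => [|/ltnW] ij; first exact: H.
  have := H j i ij; rewrite (metric_sym (pos w j) (pos w k)).
  rewrite (metric_sym (pos w k) (pos w i)) (metric_sym (pos w j) (pos w i)).
  by move=> /(_ dkj dik); rewrite addrC.
move=> dik dkj; have [ki|ik] := leqP k i.
  have := pos_quasigeodesic w ki ij.
  rewrite (metric_sym (pos w i) (pos w k)) -/C.
  by have := mdist_ge0 (pos w k) (pos w i); lra.
have [kj|jk] := leqP k j.
  by have := pos_quasigeodesic w (ltnW ik) kj; rewrite -/C; lra.
have := pos_quasigeodesic w ij (ltnW jk); rewrite -/C.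
rewrite (metric_sym (pos w j) (pos w k)).
by have := mdist_ge0 (pos w k) (pos w j); lra.
Qed.

Lemma pos_ge w n : n%:R * (m - 2 * T - 2 * delta) <= mdist (pos w n) o.
Proof.
have d0 := delta0; have t0 := T0.
elim: n => [|n IH]; first by rewrite mul0r mdist_ge0.
have := turn_backward w n; rewrite /gromov_product mdist_step.
rewrite (metric_sym o) (metric_sym o (pos w n.+1)) -[n.+1%:R]natr1.
by have := schottky_ge S (w n); lra.
Qed.

Lemma pos_le w n : mdist (pos w n) o <= n%:R * M.
Proof.
have d0 := delta0; have t0 := T0.
elim: n => [|n IH]; first by rewrite mul0r /pos /= mdistxx.
have := metric_triangle (pos w n.+1) (pos w n) o; rewrite mdist_step.
by have := schottky_le S (w n); rewrite -[n.+1%:R]natr1; lra.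
Qed.

Lemma pos_convergent w : convergent o (pos w \o succn).
Proof.
have d0 := delta0; have t0 := T0.
apply/asymptoticP => c; have L := schottky_large S.
pose s := m - 2 * T - 2 * delta; have s0 : 0 < s by rewrite /s; lra.
have [N HN] : exists N : nat, c + T + 2 * delta < N%:R * s.
  exists (Num.truncn (`|c + T + 2 * delta| / s)).+1.
  apply: le_lt_trans (ler_norm _) _.
  by rewrite -ltr_pdivrMr// truncnS_gt.
exists N => i j; wlog ij : i j / (i <= j)%N.
  move=> H Ni Nj; case: (leqP i j) => [|/ltnW] ij; first exact: H.
  by rewrite gromov_productC; exact: H.
move=> Ni _ /=.
have := gromov_product_compl o (pos w i.+1) (pos w j.+1).
have /= := @turn_all w 0 i.+1 j.+1 isT ij; rewrite {2}/pos /=.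
have := pos_ge w i.+1; rewrite -/s.
have : N%:R * s <= i.+1%:R * s.
  by rewrite ler_pM2r// ler_nat (leq_trans Ni).
by lra.
Qed.

(** Two words follow their first letters, so they branch off where these do. *)
Lemma fork0 w v i j : w 0%N != v 0%N ->
  gromov_product o (pos w i.+1) (pos v j.+1) <= M.
Proof.
have d0 := delta0; have t0 := T0.
move=> wv; have fork := schottky_fork S wv.
have first_step u n : m - T - delta <= gromov_product o (pos u 1) (pos u n.+1).
  have := gromov_product_compl o (pos u 1) (pos u n.+1).
  have := turn_forward u n; have := schottky_ge S (u 0%N).
  by rewrite {4}/pos /=; lra.
rewrite leNgt; apply/negP => big.
have ge_m : m - T - delta <= gromov_product o (pos w i.+1) (pos v j.+1).
  have := schottky_le S (w 0%N); have := schottky_ge S (w 0%N); lra.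
have := hyperbolic_le hyp (first_step w i) ge_m.
have := first_step v j; rewrite gromov_productC => vj wj.
have vj' : m - T - delta - delta <= gromov_product o (pos v j.+1) (pos v 1).
  by lra.
have := hyperbolic_le hyp wj vj'; rewrite /pos /= in fork *; lra.
Qed.

Lemma fork w v n i j : (forall k, (k < n)%N -> w k = v k) -> w n != v n ->
  (n < i)%N -> (n < j)%N ->
  gromov_product o (pos w i) (pos v j) <= n.+1%:R * M.
Proof.
have d0 := delta0; have t0 := T0.
move=> eqn neqn ni nj.
have wordE : word w n = word v n.
  elim: n eqn {neqn ni nj} => //= n IH eqn.
  by rewrite IH ?eqn// => k kn; apply: eqn; exact: ltnW.
have := gromov_product_base o (pos w n) (pos w i) (pos v j).
rewrite -(subnKC ni) -(subnKC nj) !addSnnS !posD /pos -wordE.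
rewrite gromov_product_iso; last exact: word_mdist.
have : shift w n 0%N != shift v n 0%N by rewrite /shift addn0.
move=> /(@fork0 _ _ (i - n.+1)%N (j - n.+1)%N).
have := pos_le w n; rewrite metric_sym -[n.+1%:R]natr1 /pos; lra.
Qed.

End Schottky.

(** * Visual measures *)

Section VisualMeasure.
Context {R : realType} {X : metricType R} (o : X).
Implicit Types (L : set (boundary o)) (s e c : R).

Lemma visual_premeasure_nonincreasing s L e e' : e <= e' ->
  (visual_premeasure s e' L <= visual_premeasure s e L)%E.
Proof.
move=> ee'; apply: le_ereal_inf => _ /= [xi [r [r0 cov ->]]].
exists xi, r; split=> // i; have /andP[-> re] := r0 i.
exact: le_trans re ee'.
Qed.

Lemma visual_measure_ge s L c :
  (forall e, (c%:E <= visual_premeasure s e L)%E) ->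
  (c%:E <= visual_measure s L)%E.
Proof.
move=> cL; apply: lime_ge; last by apply: nearW => e; exact: cL.
apply: nonincreasing_at_right_is_cvge; apply: nearW => x y z _ _.
exact: visual_premeasure_nonincreasing.
Qed.

Lemma visual_measure0 s L :
  (forall e c, 0 < e -> 0 < c -> (visual_premeasure s e L <= c%:E)%E) ->
  visual_measure s L = 0%E.
Proof.
move=> Le; apply: cvg_lim => //; apply: cvg_near_cst.
apply: filterS (nbhs_right_gt 0) => e e0; apply/eqP; rewrite eq_le.
apply/andP; split; first by apply/lee_addgt0Pr => c c0; rewrite add0e; exact: Le.
apply: le_ereal_inf_tmp => _ [xi [r [r0 _ ->]]].
by apply: nneseries_ge0 => i _ _; rewrite lee_fin powR_ge0.
Qed.

End VisualMeasure.

Section SchottkyMeasure.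
Context {R : realType} {X : metricType R} (o : X) (delta : R).
Context {I : finType} (g : I -> X -> X) (m M T : R).

(** All the words whose limit point lies in a visual ball of radius [r] share a
prefix of about [- ln r / M] letters; as the number of letters is at least
[expR (t * M)], the uniform measure of the corresponding cylinder is at most a
multiple of [r `^ t]. A cover with a small sum would thus be a family of
cylinders of total mass less than 1, which some word avoids. *)
Lemma schottky_visual_measure (Gamma : set (X -> X)) (t : R) (i0 : I) :
  0 <= delta -> hyperbolic_with o delta -> isometry_semigroup Gamma ->
  (forall i, Gamma (g i)) -> schottky o delta g m M T -> 0 <= T ->
  0 <= t -> expR (t * M) <= #|I|%:R ->
  visual_measure t (radial_limit_set o Gamma) <> 0%E.
Proof.
move=> d0 hyp [_ GammaM] gGamma S T0 t0 tM.
have M0 : 0 < M.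
  have := schottky_large S; have := schottky_ge S i0; have := schottky_le S i0.
  by lra.
have posGamma w n : orbit_of Gamma o (pos o g w n.+1).
  exists (word g w n.+1) => //; elim: n => [|n IH]; first exact: gGamma.
  by apply: (GammaM (word g w n.+1) (g (w n.+1))); [exact: IH|exact: gGamma].
pose u w := pos o g w \o succn.
have cu w : convergent o (u w) by exact: (pos_convergent d0 hyp S T0).
have [lim_ limP] := choice (fun w => boundary_class (cu w)).
pose c0 := expR (- (t * M + 3 * t * delta)).
suff : (c0%:E <= visual_measure t (radial_limit_set o Gamma))%E.
  by move=> + H; rewrite H lee_fin leNgt expR_gt0.
apply: visual_measure_ge => e.
apply: le_ereal_inf_tmp => _ [xi [r [r0 cov ->]]].
rewrite leNgt; apply/negP => sum_small.
(* two words with limit points in the [i]-th ball agree up to [Y i], and so have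
   a common prefix of [K i] letters by [fork] *)
pose Y i := - ln (r i) - 3 * delta.
pose K i := Num.truncn (Num.max 0 (Y i / M)).
have KP i : Y i <= M * ((K i)%:R + 1).
  rewrite mulrC -ler_pdivrMr// natr1; apply: le_trans (ltW (truncnS_gt _)).
  by rewrite le_max lexx orbT.
have KP' i n : (n < K i)%N -> n.+1%:R * M <= Y i.
  rewrite /K truncn_gt_nat le_max ler_pdivlMr// => /orP[|//].
  by rewrite leNgt ltr0Sn.
have : forall i, exists c : nat -> I, forall w,
    visual_ball (xi i) (r i) (lim_ w) -> visual_ball (xi i) (r i) (lim_ c).
  move=> i.
  have [[w H]|nw] := pselect (exists w, visual_ball (xi i) (r i) (lim_ w)).
    by exists w.
  by exists (fun=> i0) => w H; case: nw; exists w.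
move=> /choice[c cP].
have [w wP] : exists w : nat -> I, forall i,
    exists2 k, (k < K i)%N & w k <> c i k.
  apply: (@avoid_cylinders R).
  apply: (@le_lt_trans _ _
      (\sum_(0 <= i <oo) (c0^-1%:E * (r i `^ t)%:E))%E); last first.
    rewrite nneseriesZl; last by move=> *; rewrite lee_fin powR_ge0.
    rewrite -[ltRHS](_ : (c0^-1)%:E * c0%:E = 1)%E.
      by rewrite lte_pmul2l// lte_fin invr_gt0 expR_gt0.
    by rewrite -EFinM mulVf// gt_eqF// expR_gt0.
  apply: lee_nneseries => [i _ _|i _].
    by rewrite lee_fin exprn_ge0// invr_ge0.
  rewrite -EFinM lee_fin.
  have /andP[ri0 _] := r0 i.
  rewrite /powR gt_eqF// /c0 -expRN opprK -expRD.
  apply: (@le_trans _ _ (expR (- (t * M)) ^+ K i)).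
    rewrite lerXn2r ?nnegrE ?invr_ge0 ?expR_ge0// expRN.
    by rewrite lef_pV2 ?posrE ?expR_gt0 ?(lt_le_trans (expR_gt0 _) tM).
  rewrite -expRM_natl ler_expR.
  have := ler_wpM2l t0 (KP i); rewrite /Y; lra.
have [i _ lim_i] : (\bigcup_i visual_ball (xi i) (r i)) (lim_ w).
  apply: cov; exists (u w); split; [by move=> n; exact: posGamma|exact: limP|].
  exact: (pos_sub_quasi_geodesic d0 hyp S T0).
have lim_c := cP _ _ lim_i.
have [x xP] := boundary_inh (xi i).
have := agree_trans hyp (agreeC (gromov_product_bar_gt hyp xP (limP w) lim_i))
  (gromov_product_bar_gt hyp xP (limP (c i)) lim_c).
have [k kK wck] := wP i.
have ex_diff : exists n, w n != c i n by exists k; apply/eqP.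
case: (ex_minnP ex_diff) => n wcn nmin [N HN].
have nK : (n < K i)%N by apply: leq_ltn_trans kK; apply: nmin; apply/eqP.
have eq_n l : (l < n)%N -> w l = c i l.
  by move=> ln; apply/eqP; apply: contraTT ln => /nmin; rewrite -leqNgt.
have := HN (maxn n N) (maxn n N) (leq_maxr _ _) (leq_maxr _ _); rewrite /u /=.
have := @fork _ _ o _ d0 hyp _ g _ _ _ S T0 w (c i) n (maxn n N).+1 (maxn n N).+1
  eq_n wcn (leq_maxl _ _) (leq_maxl _ _).
by have := KP' _ _ nK; rewrite /Y; lra.
Qed.

End SchottkyMeasure.

(** * Counting separated orbit points *)

Lemma size_sum_filter (T : eqType) (f : T -> nat) (k : nat) (s : seq T) :
  {in s, forall x, (f x < k)%N} ->
  size s = (\sum_(j < k) size [seq x <- s | f x == j])%N.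
Proof.
elim: s => [|x s IH] fk; first by rewrite big1.
rewrite /= {}IH; last by move=> y ys; apply: fk; rewrite inE ys orbT.
have fxk : (f x < k)%N by apply: fk; rewrite mem_head.
rewrite (bigD1 (Ordinal fxk))//= [in RHS](bigD1 (Ordinal fxk))//= eqxx /= addSn.
congr (_ + _).+1%N; apply: eq_bigr => j.
by move=> /eqP jx; case: eqP => //= fxj; case: jx; apply: val_inj.
Qed.

Lemma pigeonhole (T : eqType) (f : T -> nat) (k : nat) (s : seq T) :
  (0 < k)%N -> {in s, forall x, (f x < k)%N} ->
  exists j, (size s <= k * size [seq x <- s | f x == j])%N.
Proof.
move=> k0 fk; apply: contrapT => /forallNP big.
have : (k * size s < k * size s)%N; last by rewrite ltnn.
rewrite {1}(size_sum_filter fk) big_distrr /=.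
rewrite [X in (_ < X)%N](_ : _ = \sum_(j < k) size s)%N; last first.
  by rewrite sum_nat_const card_ord.
case: k k0 big fk => // k _ big _.
rewrite !big_ord_recl -addSn leq_add//.
  by rewrite ltnNge; apply/negP; exact: big.
by apply: leq_sum => j _; rewrite leqNgt; apply/negP => /ltnW; exact: big.
Qed.

Section Counting.
Context {R : realType} {X : metricType R} (o : X).
Implicit Types (e r : R) (s : seq X) (x y : X).

Definition separated_list e s := uniq s /\
  forall x y, x \in s -> y \in s -> x <> y -> e < mdist x y.

Definition annulus (m : nat) x := m%:R <= mdist x o < m.+1%:R.

Lemma separated_list_filter e s (p : pred X) : separated_list e s ->
  separated_list e [seq x <- s | p x].
Proof.
move=> [us es]; split; first exact: filter_uniq.
by move=> x y; rewrite !mem_filter => /andP[_ xs] /andP[_ ys]; exact: es.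
Qed.

Lemma separated_list_map e s (h : X -> X) : preserves_mdist h -> separated_list e s ->
  separated_list e (map h s).
Proof.
move=> hd [us es]; have hinj : injective h.
  by move=> x y hxy; apply: mdist_positivity; rewrite -hd hxy mdistxx.
split; first by rewrite map_inj_uniq.
move=> _ _ /mapP[x xs ->] /mapP[y ys ->] xy; rewrite hd; apply: es => // xy'.
by apply: xy; rewrite xy'.
Qed.

Lemma compact_net e (K : set X) : compact K -> 0 < e ->
  exists t : seq X, forall y, K y -> exists2 z, z \in t & mdist z y < e.
Proof.
move=> cK e0; apply: contrapT => /forallNP nonet.
pose away (t : seq X) := [set y | K y /\ forall z, z \in t -> ~ mdist z y < e].
pose F : set_system X := [set A | exists t, away t `<=` A].
have PF : ProperFilter F.
  apply: Build_ProperFilter_ex.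
    move=> A [t tA]; have /existsNP[y /not_implyP[Ky yt]] := nonet t.
    by exists y; apply: tA; split=> // z zt yz; apply: yt; exists z.
  split.
  - by exists [::].
  - move=> A B [t tA] [t' tB]; exists (t ++ t') => y [Ky yt]; split.
      by apply: tA; split=> // z zt; apply: yt; rewrite mem_cat zt.
    by apply: tB; split=> // z zt; apply: yt; rewrite mem_cat zt orbT.
  - by move=> A B AB [t tA]; exists t; exact: subset_trans AB.
have [|p [Kp clp]] := cK F PF; first by exists [::] => y [].
have Fp : F (away [:: p]) by exists [:: p].
have [y [[_ /(_ p (mem_head _ _)) py]]] := clp _ _ Fp (nbhsx_ballx p _ e0).
by rewrite ballEmdist.
Qed.

Lemma separated_list_ball_bounded e r : proper_space X -> 0 < e ->
  exists N : nat, forall s, separated_list e s -> {in s, forall x, mdist o x <= r} ->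
    (size s <= N)%N.
Proof.
move=> prop e0.
have e20 : 0 < e / 2 by rewrite divr_gt0.
have [t tP] := compact_net (prop o r) e20.
exists (size t) => s [us es] sr.
have : forall x, exists y, x \in s -> y \in t /\ mdist y x < e / 2.
  move=> x; case: (boolP (x \in s)) => xs; last by exists x.
  by have [y yt xy] := tP _ (sr _ xs); exists y.
move=> /choice[f fP].
have fs : uniq (map f s).
  rewrite map_inj_in_uniq// => x y xs ys fxy; apply: contrapT => xy.
  have := es _ _ xs ys xy; have [_] := fP _ xs; have [_] := fP _ ys.
  rewrite fxy; have := metric_triangle x (f y) y; rewrite (metric_sym x (f y)).
  by lra.
rewrite -(size_map f s); apply: uniq_leq_size => // _ /mapP[x xs ->].
by have [] := fP _ xs.
Qed.

Lemma separated_list_orbit_bounded e r : proper_space X -> 0 < e ->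
  exists N : nat, forall (g : X -> X) s, isometry g -> separated_list e s ->
    {in s, forall x, mdist (g o) x <= r} -> (size s <= N)%N.
Proof.
move=> prop e0; have [N HN] := separated_list_ball_bounded r prop e0.
exists N => g s ig ss sr; have [h [hd gK hK]] := isometry_inv ig.
rewrite -(size_map h); apply: HN; first exact: separated_list_map.
by move=> _ /mapP[x xs ->]; rewrite -(gK o) hd; exact: sr.
Qed.

(** Greedy selection: keep a point, discard the points at distance at most [r]
from it, of which there are at most [N] with the point itself, and start
again. *)
Lemma separated_list_thin e r (N : nat) s : 0 <= r -> separated_list e s ->
  (forall s', separated_list e s' -> {subset s' <= s} ->
     forall x, x \in s -> {in s', forall y, mdist x y <= r} -> (size s' <= N)%N) ->
  exists s', [/\ separated_list r s', {subset s' <= s} & (size s <= N * size s')%N].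
Proof.
move=> r0; elim: {s}(size s) {-2}s (leqnn (size s)) => [|n IH] s.
  by rewrite leqn0 => /nilP -> _ _; exists [::].
case: s => [_ _ _|x s]; first by exists [::].
move=> sn ss HN; pose t := x :: s; rewrite -/t in ss HN *.
pose far := [seq y <- t | r < mdist x y].
have far_t : {subset far <= t} by move=> y; rewrite mem_filter => /andP[].
have near_le : (size [seq y <- t | (mdist x y <= r)%O] <= N)%N.
  apply: (HN _ (separated_list_filter _ ss) _ x (mem_head _ _)).
    by move=> y; rewrite mem_filter => /andP[].
  by move=> y; rewrite mem_filter => /andP[].
have size_t : size t = (size [seq y <- t | (mdist x y <= r)%O] + size far)%N.
  rewrite !size_filter -(count_predC (fun y => mdist x y <= r)%O); congr (_ + _)%N.
  by apply: eq_count => y /=; rewrite ltNge.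
have [|||s' [ss' s'far ls']] := IH far; last 1 first.
- exists (x :: s'); split.
  + split => /=.
      case: ss' => -> _; rewrite andbT; apply/negP => /s'far.
      by rewrite mem_filter mdistxx ltNge r0.
    move=> y z; rewrite !inE => /orP[/eqP ->|ys'] /orP[/eqP ->|zs'] //.
    * by move: (s'far _ zs'); rewrite mem_filter => /andP[].
    * by move: (s'far _ ys'); rewrite mem_filter metric_sym => /andP[].
    * by case: ss' => _; apply.
  + move=> y; rewrite inE => /orP[/eqP ->|/s'far /far_t//].
    exact: mem_head.
  + by rewrite size_t mulnS leq_add.
- rewrite -ltnS; apply: leq_trans sn; rewrite /t /far /=.
  rewrite mdistxx ltNge r0 /= ltnS size_filter; exact: count_size.
- exact: separated_list_filter.
- by move=> s' ss' s'f y yf; apply: HN => //; [move=> z /s'f/far_t|exact: far_t].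
Qed.

End Counting.

Section Growth.
Context {R : realType} {X : metricType R} (o : X).
Implicit Types (e r t L D C : R) (s : seq X) (x y : X) (m : nat).

(** In a proper space, passing from one separation constant to a larger one
divides the number of orbit points by a bounded amount, as the orbit looks the
same from all its points; and short orbit points are bounded in number. *)
Lemma thin_annulus (Gamma : set (X -> X)) e t L D C :
  proper_space X -> (forall g, Gamma g -> isometry g) -> 0 < e -> 0 <= t ->
  exists C', forall m s, separated_list e s ->
    {in s, forall x, orbit_of Gamma o x /\ annulus o m x} ->
    C' * expR (t * m%:R) < (size s)%:R ->
    L <= m%:R /\ exists s', [/\ separated_list D s', {subset s' <= s} &
      C * expR (t * m%:R) < (size s')%:R].
Proof.
move=> prop Giso e0 t0; pose r := Num.max 0 D.
have [N1 HN1] := separated_list_orbit_bounded o r prop e0.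
have [N2 HN2] := separated_list_ball_bounded o (L + 1) prop e0.
exists (N1%:R * `|C| + N2%:R) => m s ss sm big.
set E := expR _ in big *.
have E1 : 1 <= E by rewrite /E -[leLHS]expR0 ler_expR mulr_ge0.
have NC0 : 0 <= N1%:R * `|C| by rewrite mulr_ge0.
split.
  rewrite leNgt; apply/negP => mL; move: big; rewrite ltNge => /negP; apply.
  have sN2 : (size s <= N2)%N.
    apply: HN2 => // x xs; have [_ /andP[_]] := sm _ xs.
    by rewrite -[m.+1%:R]natr1 metric_sym; lra.
  apply: (@le_trans _ _ N2%:R); first by rewrite ler_nat.
  apply: (@le_trans _ _ (N1%:R * `|C| + N2%:R)); first by rewrite lerDr.
  by rewrite ler_peMr// addr_ge0.
have [||s' [ss' s's le]] := @separated_list_thin _ _ e r N1 s _ ss.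
- by rewrite le_max lexx.
- move=> s' ss' s's x xs near; have [[g Gg gx] _] := sm _ xs.
  by apply: (HN1 g); [exact: Giso|done|move=> y ys; rewrite gx; exact: near].
exists s'; split=> //.
  case: ss' => us' rs'; split=> // x y xs ys xy.
  by apply: le_lt_trans (rs' _ _ xs ys xy); rewrite le_max lexx orbT.
rewrite ltNge; apply/negP => small; move: big; rewrite ltNge => /negP; apply.
apply: (@le_trans _ _ (N1%:R * (size s')%:R)).
  by rewrite -natrM ler_nat.
apply: (@le_trans _ _ (N1%:R * `|C| * E)).
  rewrite -mulrA ler_wpM2l//; apply: le_trans small _.
  by rewrite ler_wpM2r ?ler_norm// (le_trans _ E1).
by rewrite ler_wpM2r ?lerDl// (le_trans _ E1).
Qed.

(** [Gamma] contains arbitrarily long, widely separated families of elements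
which have growth exponent [t] and whose products do not backtrack. Each family
is indexed by points [x] of an annulus and [F x] maps the base point near [x].
*)
Definition ample (Gamma : set (X -> X)) t := exists B T, 0 <= B /\ 0 <= T /\
  forall L D C, exists m s (F : X -> X -> X),
    [/\ separated_list D s, L <= m%:R, C * expR (t * m%:R) < (size s)%:R,
        {in s, forall x, [/\ annulus o m x, Gamma (F x) &
                             mdist (F x o) x <= B]} &
        {in s &, forall x y,
           gromov_product (F x o) o (F x (F y o)) <= T}].

Lemma ample_visual_measure (Gamma : set (X -> X)) t (delta : R) :
  0 <= delta -> hyperbolic_with o delta -> isometry_semigroup Gamma ->
  0 <= t -> ample Gamma t -> visual_measure t (radial_limit_set o Gamma) <> 0%E.
Proof.
move=> d0 hyp GammaS t0 [B [T [B0 [T0 amp]]]].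
pose D := 2 * (2 * B + T + 3 * delta + 1) + 2 * B.
have [m [s [F [[us Ds] Lm size_s Fs turn]]]] :=
  amp (B + 2 * T + 3 * delta + 1) D (expR (t * (B + 1))).
pose g (i : 'I_(size s)) := F (nth o s i).
have gs (i : 'I_(size s)) : nth o s i \in s by exact: mem_nth.
have [i0 _] : exists i0 : 'I_(size s), True.
  have : (0 < size s)%N.
    rewrite -(ltr_nat R); apply: le_lt_trans size_s.
    by rewrite mulr_ge0// expR_ge0.
  by move=> s0; exists (Ordinal s0).
apply: (@schottky_visual_measure _ _ _ delta _ g (m%:R - B) (m%:R + (B + 1)) T
  Gamma t i0 d0 hyp GammaS) => //.
- by move=> i; have [] := Fs _ (gs i).
- have dist_g i : m%:R - B <= mdist (g i o) o <= m%:R + (B + 1).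
    have [/andP[mx xm] _ Fx] := Fs _ (gs i).
    have := metric_triangle (nth o s i) (g i o) o.
    have := metric_triangle (g i o) (nth o s i) o.
    by move: xm; rewrite metric_sym -[m.+1%:R]natr1 (metric_sym o) => xm;
      rewrite (metric_sym (nth o s i) (g i o)) /g in Fx *; lra.
  split.
  + by move=> i; have [_ /(proj1 GammaS)] := Fs _ (gs i).
  + by move=> i; have /andP[] := dist_g i.
  + by move=> i; have /andP[] := dist_g i.
  + by move=> i j; exact: turn.
  + move=> i j ij; have /andP[_ gi] := dist_g i; have /andP[_ gj] := dist_g j.
    have [_ _ Fi] := Fs _ (gs i); have [_ _ Fj] := Fs _ (gs j).
    have : D < mdist (nth o s i) (nth o s j).
      apply: Ds => //; apply/eqP; rewrite nth_uniq//.
    have := metric_triangle (nth o s i) (g i o) (nth o s j).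
    have := metric_triangle (g i o) (g j o) (nth o s j).
    rewrite (metric_sym (nth o s i) (g i o)) /gromov_product /D.
    by rewrite /g in gi gj Fi Fj *; lra.
  + by lra.
- rewrite card_ord mulrDr expRD mulrC; exact: ltW.
Qed.

End Growth.

(** * Directions of exponential growth *)

Section Sparse.
Context {R : realType} {X : metricType R} (o : X).
Implicit Types (P Q : set X) (t e L : R).

(** Cardinality is bounded through lists of distinct points, which makes sense for
infinite sets as well.  The sparse sets form an ideal, the one to which
[agree_accumulation] is applied. *)
Definition sparse t P := exists C, forall m s, uniq s ->
  {in s, forall x, P x /\ annulus o m x} -> (size s)%:R <= C * expR (t * m%:R).

Lemma sparse_sub t P Q : P `<=` Q -> sparse t Q -> sparse t P.
Proof.
move=> PQ [C HC]; exists C => m s us sP; apply: HC => // x /sP[Px xm].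
by split=> //; exact: PQ.
Qed.

Lemma sparse_union t P Q : sparse t P -> sparse t Q -> sparse t (P `|` Q).
Proof.
move=> [C HC] [C' HC']; exists (C + C') => m s us sPQ.
pose p x := `[< P x >].
rewrite -(count_predC p s) natrD mulrDl -!size_filter.
apply: lerD; [apply: HC|apply: HC']; rewrite ?filter_uniq// => x.
  by rewrite mem_filter => /andP[/asboolP Px /sPQ[]].
by rewrite mem_filter => /andP[/asboolPn nPx /sPQ[[]]].
Qed.

Lemma sparse_le t t' P : t <= t' -> sparse t P -> sparse t' P.
Proof.
move=> tt' [C HC]; exists `|C| => m s us sP; apply: le_trans (HC _ _ us sP) _.
apply: (@le_trans _ _ (`|C| * expR (t * m%:R))).
  by rewrite ler_wpM2r ?expR_ge0 ?ler_norm.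
by rewrite ler_wpM2l// ler_expR ler_wpM2r.
Qed.

Lemma sparse_bounded t e L P : proper_space X -> 0 < e -> 0 <= t ->
  (forall x y, P x -> P y -> x <> y -> e < mdist x y) ->
  sparse t [set x | P x /\ mdist x o <= L].
Proof.
move=> prop e0 t0 Pe; have [N HN] := separated_list_ball_bounded o L prop e0.
exists N%:R => m s us sP; apply: (@le_trans _ _ N%:R).
  rewrite ler_nat; apply: HN; last by move=> x /sP[[_ ?] _]; rewrite metric_sym.
  by split=> // x y /sP[[Px _] _] /sP[[Py _] _]; exact: Pe.
by rewrite ler_peMr// -[leLHS]expR0 ler_expR mulr_ge0.
Qed.

End Sparse.

Lemma natr_sqr_le_expR (R : realType) (a : R) : 0 < a ->
  exists2 K, 0 < K & forall m : nat, m.+1%:R ^+ 2 <= K * expR (a * m%:R).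
Proof.
move=> a0; pose b := Num.min 1 (a / 2).
have b0 : 0 < b by rewrite lt_min ltr01 divr_gt0.
exists (b ^- 2); first by rewrite invr_gt0 exprn_gt0.
move=> m; rewrite mulrC ler_pdivlMr ?exprn_gt0// -exprMn.
rewrite (_ : a * m%:R = 2%:R * (a / 2 * m%:R)); last by lra.
rewrite expRM_natl lerXn2r ?nnegrE ?expR_ge0 ?mulr_ge0 ?(ltW b0)//.
apply: le_trans (expR_ge1Dx _).
have : b <= 1 by rewrite ge_min lexx.
have : m%:R * b <= m%:R * (a / 2) by rewrite ler_wpM2l// ge_min lexx orbT.
by rewrite -natr1; lra.
Qed.

Section Directions.
Context {R : realType} {X : metricType R} (o : X) (delta : R).
Hypotheses (delta0 : 0 <= delta) (hyp : hyperbolic_with o delta).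
Hypotheses (prop : proper_space X) (cpt : compact (boundary_set o)).
Context (Gamma : set (X -> X)) (GammaS : isometry_semigroup Gamma).

Let Giso : forall f, Gamma f -> isometry f := proj1 GammaS.
Let GM : forall f h, Gamma f -> Gamma h -> Gamma (f \o h) := proj2 GammaS.

(* [P] is a separated part of the orbit, [G x] an element that reaches [x] and
   [G' x] the inverse of [G x] *)
Context (P : set X) (e : R) (G G' : X -> X -> X).
Hypotheses (e0 : 0 < e) (Pe : forall x y, P x -> P y -> x <> y -> e < mdist x y).
Hypotheses (GG : forall x, P x -> Gamma (G x)) (Go : forall x, P x -> G x o = x).
Hypotheses (GK : forall x, P x -> cancel (G x) (G' x))
  (GK' : forall x, P x -> cancel (G' x) (G x)).

Lemma family_orbit x : P x -> orbit_of Gamma o x.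
Proof. by move=> Px; exists (G x); [exact: GG|exact: Go]. Qed.

Lemma family_iso x : P x -> isometry (G x).
Proof. by move=> /GG/Giso. Qed.

Lemma family_mdist x : P x -> preserves_mdist (G x).
Proof. by move=> /family_iso[]. Qed.

Lemma family_inverse_iso x : P x -> isometry (G' x).
Proof.
move=> Px; split; first by exists (G x); [exact: GK'|exact: GK].
by move=> y z; rewrite -(family_mdist Px) !GK'.
Qed.

Lemma family_inverse_mdist x : P x -> mdist (G' x o) o = mdist x o.
Proof. by move=> Px; rewrite -(family_mdist Px) GK'// Go// metric_sym. Qed.

(** The points of a non-negligible part of the orbit accumulate, both themselves
and through the inverses of the elements that reach them, at boundary points
all of whose neighbourhoods are non-negligible. *)
Lemma growth_directions t xi eta :
  0 <= t -> ~ sparse o t P -> convergent o xi -> convergent o eta ->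
  ~ asymptotic o xi eta ->
  exists u v, [/\ convergent o u, convergent o v & forall c,
    ~ sparse o t [set x | P x /\ (agree o (fun=> x) u c /\
                                  agree o (fun=> G' x o) v c)]].
Proof.
move=> t0 nP cxi ceta nxieta.
have [K HK] := isometry_near_boundary hyp cxi ceta nxieta.
have [u [cu uP]] : exists u, convergent o u /\
    forall c, ~ sparse o t [set x | P x /\ agree o (fun=> x) u c].
  apply: (agree_accumulation (f := id) (K := K) hyp cpt _ _ nP).
  - exact: sparse_sub.
  - exact: sparse_union.
  - by move=> L; exact: (sparse_bounded o L prop e0 t0 Pe).
  - by move=> x Px; have := HK _ (family_iso Px); rewrite Go.
(* for the inverses, the negligible sets are those which are sparse near [u] *)
have near_u c c' : c' <= c -> [set x | agree o (fun=> x) u c] `<=`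
    [set x | agree o (fun=> x) u c'].
  by move=> cc' x; exact: agree_le.
pose J (Q : set X) := exists c, sparse o t [set x | Q x /\ agree o (fun=> x) u c].
have [v [cv vP]] : exists v, convergent o v /\
    forall c, ~ J [set x | P x /\ agree o (fun=> G' x o) v c].
  apply: (agree_accumulation (f := fun x => G' x o) (K := K) hyp cpt).
  - move=> A B AB [c HB]; exists c; apply: sparse_sub HB => x [/AB Bx xu].
    by split.
  - move=> A B [c HA] [c' HB]; exists (Num.max c c').
    apply: sparse_sub (sparse_union HA HB) => x [[Ax|Bx] xu].
      by left; split=> //; apply: near_u xu; rewrite le_max lexx.
    by right; split=> //; apply: near_u xu; rewrite le_max lexx orbT.
  - by move=> [c]; exact: uP.
  - move=> L; exists 0.
    apply: sparse_sub (sparse_bounded o L prop e0 t0 Pe) => x [[Px xL] _].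
    by split=> //; rewrite -(family_inverse_mdist Px).
  - by move=> x Px; exact: HK (family_inverse_iso Px).
exists u, v; split=> // c sp; apply: (vP c); exists c.
by apply: sparse_sub sp => x [[Px xv] xu].
Qed.

(** The backtracking of a product is the Gromov product of the inverse of its
left factor with its right factor. *)
Lemma turnE f h x : P x -> preserves_mdist f -> cancel h f ->
  forall y, gromov_product (G x (f o)) o (G x (f y)) =
    gromov_product o (h (G' x o)) y.
Proof.
move=> Px fd hK y; rewrite -[RHS](gromov_product_iso _ _ _ fd).
by rewrite -[RHS](gromov_product_iso _ _ _ (family_mdist Px)) hK GK'.
Qed.

Lemma ample_right t T f (Q : set X) : 0 <= t -> 0 <= T -> preserves_mdist f ->
  Q `<=` P -> ~ sparse o t Q -> (forall x, Q x -> Gamma (G x \o f)) ->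
  (forall x y, Q x -> Q y ->
    gromov_product (G x (f o)) o (G x (f (G y (f o)))) <= T) ->
  ample o Gamma t.
Proof.
move=> t0 T0 fd QP nQ QG Qturn; exists (mdist (f o) o), T.
split; [exact: mdist_ge0|split=> //] => L D C.
have [C' HC'] := thin_annulus o L D C prop Giso e0 t0.
have /forallNP/(_ C')/existsNP[m /existsNP[s /not_implyP[us /not_implyP[sQ]]]] := nQ.
move=> /negP; rewrite -ltNge => big.
have [||Lm [s' [ss' s's big']]] := HC' m s _ _ big.
- by split=> // x y /sQ[/QP Px _] /sQ[/QP Py _]; exact: Pe.
- by move=> x /sQ[/QP Px xm]; split=> //; exact: family_orbit.
exists m, s', (fun x => G x \o f); split=> //.
- move=> x /s's/sQ[Qx xm]; split=> //; first exact: QG.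
  have Px := QP _ Qx.
  by rewrite /= -[X in mdist _ X](Go Px) (family_mdist Px).
- by move=> x y /s's/sQ[Qx _] /s's/sQ[Qy _]; exact: Qturn.
Qed.


(** A point away from [u] is away from all the points close to [u]. *)
Lemma branch_point u x z c : ~ agree o (fun=> z) u c ->
  agree o (fun=> x) u (c + delta) -> gromov_product o z x <= c + delta.
Proof.
move=> nzu xu; rewrite leNgt; apply/negP => zx; apply: nzu.
rewrite -(addrK delta c); apply: (agree_trans hyp) xu.
by exists 0%N.
Qed.

(** Images of the base point are close to [u] and its images under inverses are
close to [v], so their Gromov products are bounded by that of [u] and [v], up to
a multiple of [delta]. *)
Lemma ample_transverse t u v : 0 <= t -> ~ asymptotic o u v ->
  (forall c, ~ sparse o t [set x | P x /\ (agree o (fun=> x) u c /\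
                                  agree o (fun=> G' x o) v c)]) ->
  ample o Gamma t.
Proof.
have d0 := delta0.
move=> t0 /asymptoticP/existsNP[c nuv] nP; pose T := Num.max 0 c.
have T0 : 0 <= T by rewrite le_max lexx.
apply: (@ample_right t (T + 2 * delta) id _ t0 _ _ _ (nP (T + 2 * delta))) => //.
- by rewrite addr_ge0 ?mulr_ge0.
- by move=> x [].
- by move=> x [Px _]; exact: GG.
move=> x y [Px [_ xv]] [Py [yu _]].
rewrite (@turnE id id)// Go// gromov_productC.
have -> : T + 2 * delta = T + delta + delta by lra.
apply: (branch_point (u := v)); last by apply: agree_le xv; lra.
move=> yv; apply: nuv; apply: (@agree_le _ _ _ _ _ T).
  by rewrite le_max lexx orbT.
rewrite -(addrK delta T); apply: (agree_trans hyp) yv; apply: agreeC.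
by apply: agree_le yu; lra.
Qed.

(** If the elements of the family and their inverses have the same direction
[u], composing on the right with [g] turns the inverses away from [u], unless
the inverse of [g] itself points towards [u]. *)
Lemma ample_twist t u T Z g h : 0 <= t -> 0 <= Z ->
  Gamma g -> preserves_mdist h -> cancel h g -> cancel g h ->
  (forall c, ~ sparse o t [set x | P x /\ (agree o (fun=> x) u c /\
                                  agree o (fun=> G' x o) u c)]) ->
  ~ agree o (fun=> g o) u T -> ~ agree o (fun=> h o) u Z ->
  T + Z + 2 * delta < mdist (g o) o ->
  ample o Gamma t.
Proof.
have d0 := delta0.
move=> t0 Z0 Gg hd hK gK nP ngu nhu g_long; have [_ gd] := Giso Gg.
(* the first bound lets [g o] be compared with the inverses, the second one keeps
   the images close to [u] after a displacement by [mdist (g o) o] *)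
pose c := Num.max (T + delta) (Z + 2 * delta + mdist (g o) o).
apply: (@ample_right t (Z + 2 * delta) g _ t0 _ _ _ (nP c)) => //.
- by rewrite addr_ge0 ?mulr_ge0.
- by move=> x [].
- by move=> x [Px _]; apply: GM => //; exact: GG.
move=> x y [Px [_ xu]] [Py [yu _]].
rewrite (@turnE g h)//.
have -> : Z + 2 * delta = Z + delta + delta by lra.
apply: (branch_point (u := u)); last first.
  have [N HN] := yu; exists N => i j Ni Nj.
  have := HN _ _ Ni Nj; have := gromov_product_lip o (G y (g o)) y (u j).
  have -> : mdist (G y (g o)) y = mdist (g o) o.
    by rewrite -[X in mdist _ X](Go Py) (family_mdist Py).
  have : Z + 2 * delta + mdist (g o) o <= c by rewrite le_max lexx orbT.
  by lra.
have gx : gromov_product o (g o) (G' x o) <= T + delta.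
  by apply: (branch_point (u := u)) => //; apply: agree_le xu; rewrite le_max lexx.
move=> hxu; apply: nhu; rewrite -(addrK delta Z); apply: (agree_trans hyp) hxu.
exists 0%N => _ _ _ _; rewrite -(gromov_product_iso _ _ _ gd) !hK.
have := gromov_product_compl o (g o) (G' x o); lra.
Qed.

Section Shorten.
Context (g h : X -> X).
Hypotheses (Gg : Gamma g) (hK : cancel h g) (gK : cancel g h).

Let g_mdist : preserves_mdist g. Proof. by case: (Giso Gg). Qed.

Let p := h o.
Let ell := mdist (g o) o.

Let mdist_p : mdist p o = ell.
Proof. by rewrite -g_mdist /p hK metric_sym. Qed.

(** [y] points towards [p], so that [g] brings it closer to the base point. *)
Definition shortens y := ell / 2 + delta + 1 < gromov_product o y p.

Lemma shortens_le y : shortens y -> mdist (g y) o + (2 * delta + 2) <= mdist y o.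
Proof.
rewrite /shortens /gromov_product mdist_p => yp.
by have := g_mdist y p; rewrite /p hK => ->; rewrite -/p; lra.
Qed.

Lemma shortens_iter y k : (forall j, (j < k)%N -> shortens (iter j g y)) ->
  mdist (iter k g y) o + k%:R * (2 * delta + 2) <= mdist y o.
Proof.
elim: k => [|k IH] H; first by rewrite mul0r addr0.
have := IH (fun j jk => H j (ltnW jk)); have := shortens_le (H k (ltnSn k)).
by rewrite /= -[k.+1%:R]natr1; lra.
Qed.

Lemma shortens_stop y : exists N, ~ shortens (iter N g y) /\
  forall j, (j < N)%N -> shortens (iter j g y).
Proof.
have d0 := delta0.
have ex : exists N, `[< ~ shortens (iter N g y) >].
  apply: contrapT => /forallNP all_short.
  pose k := (Num.truncn (mdist y o)).+1.
  have short j : (j < k)%N -> shortens (iter j g y).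
    by move=> _; apply: contrapT => nj; apply: (all_short j); apply/asboolP.
  have := shortens_iter short; have := truncnS_gt (mdist y o); rewrite -/k.
  have : k%:R * 1 <= k%:R * (2 * delta + 2) by rewrite ler_wpM2l//; lra.
  by have := mdist_ge0 (iter k g y) o; lra.
case: (ex_minnP ex) => N /asboolP nN minN; exists N; split=> // j jN.
apply: contrapT => /asboolP /minN; rewrite leqNgt.
by rewrite jN.
Qed.

(** The inverses of the successive products [g ^ k * G x] keep the direction of
the inverse of [G x].  The errors do not add up because the lengths decrease by
more than [delta] at each step. *)
Lemma shortens_inverse x k : P x -> (forall j, (j < k)%N -> shortens (iter j g x)) ->
  mdist (iter k g x) o - ell <=
  gromov_product o (G' x (iter k h o)) (G' x o).
Proof.
have d0 := delta0.
move=> Px; elim: k => [_|k IH H] /=.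
  rewrite gromov_productxx family_inverse_mdist//.
  by have := mdist_ge0 (g o) o; rewrite -/ell; lra.
have {}IH := IH (fun j jk => H j (ltnW jk)).
have /= short := shortens_le (H k (ltnSn k)).
have gkh y : iter k g (iter k h y) = y.
  by elim: k y {IH H short} => // k IHk y; rewrite [iter k.+1 h y]iterSr /= IHk hK.
have gkd : preserves_mdist (iter k g).
  by elim: k {IH H short gkh} => [|k IHk] y z //=; rewrite g_mdist IHk.
have step : mdist (iter k g x) o - ell <=
    gromov_product o (G' x (iter k.+1 h o)) (G' x (iter k h o)).
  rewrite -(gromov_product_iso _ _ _ (family_mdist Px)) !GK'// Go//.
  rewrite -(gromov_product_iso _ _ _ gkd) gkh iterSr gkh -/p gromov_productC.
  have := gromov_product_compl o (iter k g x) p.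
  have := gromov_product_lel o p (iter k g x).
  by rewrite gromov_productC mdist_p; lra.
have := hyperbolic_le hyp step IH; rewrite /=; lra.
Qed.

(** If [g^-1] points towards [u], the elements of the family, which also point
towards [u], are shortened by powers of [g] until they do not any more; their
inverses still do.  The exponents are bounded by the lengths, which costs a
polynomial factor only. *)
Lemma ample_shorten t t1 u : 0 <= t -> t < t1 -> preserves_mdist h ->
  (forall c, ~ sparse o t1 [set x | P x /\ (agree o (fun=> x) u c /\
                                  agree o (fun=> G' x o) u c)]) ->
  agree o (fun=> p) u (ell / 2 + 2 * delta + 1) ->
  ample o Gamma t.
Proof.
have d0 := delta0.
move=> t0 tt1 hd nP pu; set Z := _ + 1 in pu.
have ell0 : 0 <= ell by exact: mdist_ge0.
exists 0, (Z + delta); split=> //; split=> [|L D C].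
  by rewrite /Z !addr_ge0 ?mulr_ge0 ?divr_ge0.
(* elements of length at least [L'] have inverses close to [u] by
   [shortens_inverse] *)
pose L' := Num.max L (Z + 2 * delta + ell + 1).
have [C' HC'] := thin_annulus o L' D C prop Giso e0 t0.
have tt10 : 0 < t1 - t by lra.
have [K K0 HK] := natr_sqr_le_expR tt10.
have /forallNP/(_ (`|C'| * K)) := nP (Z + 2 * delta).
move=> /existsNP[m /existsNP[s /not_implyP[us /not_implyP[sQ]]]].
move=> /negP; rewrite -ltNge => big.
have [N NP] := choice shortens_stop.
pose y x := iter (N x) g x.
have sP x : x \in s -> P x by move=> /sQ[[]].
have y_le x : mdist (y x) o + (N x)%:R * 2 <= mdist x o.
  have [_ /shortens_iter] := NP x; rewrite -/(y x).
  have : (N x)%:R * 2 <= (N x)%:R * (2 * delta + 2) by rewrite ler_wpM2l//; lra.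
  by lra.
have x_lt x : x \in s -> mdist x o < m.+1%:R by move=> /sQ[_ /andP[]].
have NsP : {in s, forall x, (N x < m.+1)%N}.
  move=> x xs; rewrite -(ltr_nat R); apply: le_lt_trans (x_lt _ xs).
  have := y_le x; have := mdist_ge0 (y x) o; have : 0 <= (N x)%:R :> R by [].
  by lra.
(* keep one value [k] of the exponent, then one length [m'] of the products *)
have [k Hk] := pigeonhole (ltn0Sn m) NsP; set s1 := [seq x <- s | _] in Hk.
pose M x := Num.truncn (mdist (y x) o).
have s1s : {subset s1 <= s} by move=> x; rewrite mem_filter => /andP[].
have M_le x : x \in s -> (M x < m.+1)%N.
  move=> xs; rewrite -(ltr_nat R); apply: le_lt_trans (x_lt _ xs).
  apply: (@le_trans _ _ (mdist (y x) o)); first by rewrite truncn_le mdist_ge0.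
  by have := y_le x; have : 0 <= (N x)%:R :> R by []; lra.
have Ms1 : {in s1, forall x, (M x < m.+1)%N} by move=> x /s1s/M_le.
have [m' Hm'] := pigeonhole (ltn0Sn m) Ms1; set s2 := [seq x <- s1 | _] in Hm'.
have s2s1 : {subset s2 <= s1} by move=> x; rewrite mem_filter => /andP[].
have s2k x : x \in s2 -> N x = k.
  by move=> /s2s1; rewrite mem_filter => /andP[/eqP].
have s2m x : x \in s2 -> M x = m'.
  by rewrite mem_filter => /andP[/eqP].
have big2 : C' * expR (t * m'%:R) < (size s2)%:R.
  have [/eqP s20|s20] := eqVneq (size s2) 0%N.
    move: Hm' Hk; rewrite (eqP s20) muln0 leqn0 => /eqP ->.
    rewrite muln0 leqn0 => /eqP ss0; move: big; rewrite ss0 ltNge => /negP[].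
    by rewrite !mulr_ge0 ?expR_ge0// ltW.
  have m'm : (m' <= m)%N.
    have : has predT s2 by rewrite has_predT lt0n.
    move=> /hasP[x xs2 _]; rewrite -(s2m _ xs2) -ltnS.
    exact: M_le (s1s _ (s2s1 _ xs2)).
  apply: (@le_lt_trans _ _ (`|C'| * expR (t * m%:R))).
    apply: (@le_trans _ _ (`|C'| * expR (t * m'%:R))).
      by rewrite ler_wpM2r ?expR_ge0 ?ler_norm.
    by rewrite ler_wpM2l// ler_expR ler_wpM2l// ler_nat.
  rewrite -(ltr_pM2l (_ : 0 < K * expR ((t1 - t) * m%:R))); last first.
    by rewrite mulr_gt0 ?expR_gt0.
  rewrite (_ : _ * (_ * _) = `|C'| * K * expR (t1 * m%:R)); last first.
    rewrite (_ : t1 * m%:R = (t1 - t) * m%:R + t * m%:R) ?expRD; last by lra.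
    by rewrite mulrACA [K * _]mulrC -mulrA.
  apply: lt_le_trans big _.
  apply: (@le_trans _ _ (m.+1%:R ^+ 2 * (size s2)%:R)); last first.
    by rewrite ler_wpM2r.
  rewrite -natrX -natrM ler_nat expnS expn1 -mulnA.
  by apply: leq_trans Hk _; rewrite leq_mul2l Hm'.
pose s3 := map (iter k g) s2.
have gkd j : preserves_mdist (iter j g).
  by elim: j => [|j IHj] a b //=; rewrite g_mdist IHj.
have hgk j a : iter j h (iter j g a) = a.
  by elim: j a => // j IHj a; rewrite [iter j.+1 g a]iterSr /= IHj gK.
have ghk j a : iter j g (iter j h a) = a.
  by elim: j a => // j IHj a; rewrite [iter j.+1 h a]iterSr /= IHj hK.
have sep2 : separated_list e s2.
  split; first by rewrite !filter_uniq.
  by move=> a b /s2s1/s1s/sP Pa /s2s1/s1s/sP; exact: Pe.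
have FG x : P x -> Gamma (iter k g \o G x).
  move=> Px; elim: k {Hk Hm' s1 s2 s3 s1s Ms1 s2s1 s2k s2m big2 sep2} => [|j IHj].
    exact: GG.
  exact: (GM Gg IHj).
have s3P a : a \in s3 -> exists2 x, x \in s2 & a = iter k g x.
  by move=> /mapP.
have ann a : a \in s3 -> annulus o m' a.
  move=> /s3P[x xs2 ->]; rewrite -(s2k _ xs2) -/(y x) -(s2m _ xs2) /annulus.
  by rewrite truncn_le mdist_ge0 truncnS_gt.
have [||L'm [s' [ss' s's big']]] := HC' m' s3 (separated_list_map (gkd k) sep2) _ _.
- move=> a as3; split; last exact: ann.
  have [x /s2s1/s1s/sP Px ->] := s3P _ as3.
  by exists (iter k g \o G x); [exact: FG|rewrite /= Go].
- by rewrite size_map.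
exists m', s', (fun a => iter k g \o G (iter k h a)); split=> //.
- by apply: le_trans L'm; rewrite le_max lexx.
- move=> a /s's as3; have [x /s2s1/s1s/sP Px aE] := s3P _ as3.
  split; first exact: ann.
    by rewrite aE hgk; exact: FG.
  by rewrite aE hgk /= Go// mdistxx.
move=> a b /s's as3 /s's bs3; have am := ann _ as3.
have [x xs2 aE] := s3P _ as3; have [x' xs2' bE] := s3P _ bs3.
have xs := s1s _ (s2s1 _ xs2); have Px := sP _ xs.
have Px' := sP _ (s1s _ (s2s1 _ xs2')).
rewrite aE bE !hgk /= !Go//.
have -> : gromov_product (iter k g x) o (iter k g (G x (iter k g x'))) =
    gromov_product o (iter k g x') (G' x (iter k h o)).
  rewrite -[RHS](gromov_product_iso _ _ _ (family_mdist Px)) GK'// Go//.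
  by rewrite -[RHS](gromov_product_iso _ _ _ (gkd k)) ghk gromov_productC.
have [stop _] := NP x'; have [_ short] := NP x.
rewrite (s2k _ xs2') in stop; rewrite (s2k _ xs2) in short.
have [[_ [_ xu]] _] := sQ _ xs.
apply: (branch_point (u := u)).
  move=> yu; apply: stop; rewrite /shortens.
  have := agree_trans hyp yu (agreeC pu); move=> [j /(_ j j)].
  by rewrite leqnn /Z => /(_ isT isT); lra.
have -> : Z + delta = Z + 2 * delta - delta by lra.
apply: (agree_trans hyp) xu; exists 0%N => _ _ _ _.
have := shortens_inverse Px short; rewrite -aE.
have : Z + 2 * delta + ell + 1 <= mdist a o.
  have /andP[ma _] := am; apply: le_trans ma; apply: le_trans L'm.
  by rewrite le_max lexx orbT.
by lra.
Qed.

End Shorten.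


(** A limit point different from the common direction [u] of the family provides
the element [g] used to separate the family from its inverses. *)
Lemma growth_ample t t1 (xi eta : boundary o) : 0 <= t -> t < t1 ->
  ~ sparse o t1 P -> limit_set o Gamma xi -> limit_set o Gamma eta ->
  xi <> eta -> ample o Gamma t.
Proof.
have d0 := delta0.
move=> t0 tt1 nP [a aG xa] [b bG etab] xieta.
have nab : ~ asymptotic o a b by move/(boundary_eq hyp xa etab).
have ca := boundary_convergent xa; have cb := boundary_convergent etab.
have t10 : 0 <= t1 by exact: le_trans t0 (ltW tt1).
have [u [v [cu cv nQ]]] := growth_directions t10 nP ca cb nab.
have [uv|nuv] := pselect (asymptotic o u v); last first.
  apply: (ample_transverse t0 nuv) => c; apply: contra_not (nQ c).
  by apply: sparse_le; exact: ltW.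
have {}nQ c : ~ sparse o t1 [set x | P x /\ (agree o (fun=> x) u c /\
                                  agree o (fun=> G' x o) u c)].
  apply: contra_not (nQ (c + delta)); apply: sparse_sub => x [Px [xu xv]].
  split=> //; split; first by apply: agree_le xu; lra.
  rewrite -(addrK delta c); apply: (agree_trans hyp) xv _.
  by have /asymptoticP := asymptotic_sym uv.
have [w [wG cw nuw]] : exists w, [/\ forall n, orbit_of Gamma o (w n),
    convergent o w & ~ asymptotic o u w].
  have [ua|nua] := pselect (asymptotic o u a); last by exists a.
  exists b; split=> // ub; apply: nab.
  exact: (asymptotic_trans hyp (asymptotic_sym ua) ub).
have /asymptoticP/existsNP[c nc] := nuw.
have [N HN] := disagree hyp cu cw nc.
pose T := c + 2 * delta.
have [M HM] := convergent_dist (2 * (`|T| + 4 * delta + 1)) cw.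
have [g Gg gw] := wG (maxn N M).
have g_long : 2 * (`|T| + 4 * delta + 1) < mdist (g o) o.
  by rewrite gw; apply: HM; rewrite leq_maxr.
have [h [hd gK hK]] := isometry_inv (Giso Gg).
have ngu : ~ agree o (fun=> g o) u T.
  move=> [j /(_ (maxn N j) (maxn N j) (leq_maxr _ _) (leq_maxr _ _))].
  rewrite gw gromov_productC ltNge => /negP; apply.
  by apply: HN; rewrite leq_maxl.
have [hu|nhu] := pselect (agree o (fun=> h o) u (mdist (g o) o / 2 + 2 * delta + 1)).
  exact: (ample_shorten Gg hK gK t0 tt1 hd nQ hu).
have nQt c' : ~ sparse o t [set x | P x /\ (agree o (fun=> x) u c' /\
                                  agree o (fun=> G' x o) u c')].
  by apply: contra_not (nQ c'); apply: sparse_le; exact: ltW.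
apply: (ample_twist t0 _ Gg hd hK gK nQt ngu nhu).
  by have := mdist_ge0 (g o) o; lra.
by have := ler_norm T; lra.
Qed.

End Directions.

(** * Growth exponents and counting *)

Section CountingSeq.
Context {R : realType} {T : choiceType}.
Implicit Types (A : set T) (s : seq T) (c : R).

Lemma counting_le A c :
  (forall s, uniq s -> {in s, forall x, A x} -> (size s)%:R <= c) ->
  (counting A <= c%:E)%E.
Proof.
move=> Ac; rewrite /counting; case: asboolP => [fA|infA].
  rewrite lee_fin; apply: Ac; first exact: fset_uniq.
  by move=> x; rewrite in_fset_set// => /set_mem.
have c0 : 0 <= c by apply: (Ac [::]).
have [B BA nB] := infinite_set_fset (Num.truncn c).+1 infA.
have := Ac B (fset_uniq B) BA; rewrite leNgt => /negP[].
by apply: lt_le_trans (truncnS_gt c) _; rewrite ler_nat.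
Qed.

Lemma size_le_counting A c s : (counting A <= c%:E)%E -> uniq s ->
  {in s, forall x, A x} -> (size s)%:R <= c.
Proof.
rewrite /counting; case: asboolP => [fA|//]; rewrite lee_fin => Ac us sA.
apply: le_trans Ac; rewrite ler_nat; apply: uniq_leq_size => // x xs.
by rewrite in_fset_set//; apply/mem_set/sA.
Qed.

End CountingSeq.

Section GrowthExponent.
Context {R : realType} {X : metricType R} (o : X).
Implicit Types (A : set X) (t : R).

Let rate A (n : nat) : \bar R :=
  ((n%:R^-1)%:E * lne (counting (ball o n%:R `&` A)))%E.

Lemma counting_ge0 A : (0 <= counting A :> \bar R)%E.
Proof. by rewrite /counting; case: asboolP. Qed.

Lemma rate_leP A n t : (0 < n)%N ->
  (rate A n <= t%:E)%E <->
  (counting (ball o n%:R `&` A) <= (expR (t * n%:R))%:E)%E.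
Proof.
move=> n0; rewrite /rate; have n0' : 0 < n%:R^-1 :> R by rewrite invr_gt0 ltr0n.
have -> : t%:E = ((n%:R^-1)%:E * (t * n%:R)%:E)%E.
  by rewrite -EFinM mulrCA mulVf ?mulr1// pnatr_eq0 -lt0n.
rewrite lee_pmul2l//.
have -> : (t * n%:R)%:E = lne (expR (t * n%:R))%:E.
  by rewrite lne_EFin ?expR_gt0// expRK.
rewrite lee_lne ?in_itv//= ?leey ?andbT ?counting_ge0//.
Qed.

Lemma growth_exponent_lt A t : (growth_exponent o A < t%:E)%E ->
  exists N, forall n, (N <= n)%N -> (0 < n)%N ->
    (counting (ball o n%:R `&` A) <= (expR (t * n%:R))%:E)%E.
Proof.
move=> /ereal_inf_lt[_ [V [N _ NV] <-] Vt]; exists N => n Nn n0.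
apply/rate_leP => //; apply: le_trans (ltW Vt); apply: ereal_sup_ubound.
by exists n => //; exact: NV.
Qed.

Lemma growth_exponent_le A t N :
  (forall n, (N <= n)%N -> (0 < n)%N ->
    (counting (ball o n%:R `&` A) <= (expR (t * n%:R))%:E)%E) ->
  (growth_exponent o A <= t%:E)%E.
Proof.
move=> At; apply: (@le_trans _ _ (ereal_sup (rate A @` [set n | (N.+1 <= n)%N]))).
  apply: ereal_inf_lbound; exists [set n | (N.+1 <= n)%N] => //.
  by exists N.+1.
apply: ge_ereal_sup => _ [n /= Nn <-]; apply/rate_leP.
  exact: leq_trans Nn.
by apply: At; [exact: ltnW|exact: leq_trans Nn].
Qed.

Lemma size_ball_le A n s (f : nat -> R) : uniq s ->
  {in s, forall x, (ball o n%:R `&` A) x} ->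
  (forall m s', uniq s' -> {in s', forall x, A x /\ annulus o m x} ->
     (size s')%:R <= f m) ->
  (size s)%:R <= \sum_(m < n) f m.
Proof.
move=> us sA Af; pose M x := Num.truncn (mdist x o).
have Mn : {in s, forall x, (M x < n)%N}.
  move=> x /sA[+ _]; rewrite ballEmdist /= metric_sym => xn.
  rewrite -(ltr_nat R); apply: le_lt_trans xn.
  by rewrite truncn_le mdist_ge0.
rewrite (size_sum_filter Mn) natr_sum; apply: ler_sum => m _.
apply: Af; first exact: filter_uniq.
move=> x; rewrite mem_filter => /andP[/eqP <- /sA[_ Ax]]; split=> //.
by rewrite /annulus truncn_le mdist_ge0 truncnS_gt.
Qed.

Lemma sparse_growth_exponent A t t1 : 0 <= t -> t < t1 -> sparse o t A ->
  (growth_exponent o A <= t1%:E)%E.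
Proof.
move=> t0 tt1 [C HC]; pose a := (t1 - t) / 2; have a0 : 0 < a by rewrite /a; lra.
have [K K0 HK] := natr_sqr_le_expR a0.
pose N := (Num.truncn (`|C| * K / a)).+1.
apply: (growth_exponent_le (N := N)) => n Nn n0.
apply: counting_le => s us sA; apply: le_trans (size_ball_le us sA HC) _.
apply: (@le_trans _ _ (\sum_(m < n) `|C| * expR (t * n%:R))).
  apply: ler_sum => m _; apply: (@le_trans _ _ (`|C| * expR (t * m%:R))).
    by rewrite ler_wpM2r ?expR_ge0 ?ler_norm.
  by rewrite ler_wpM2l// ler_expR ler_wpM2l// ler_nat ltnW.
rewrite sumr_const card_ord -[leLHS]mulr_natr.
have -> : t1 * n%:R = t * n%:R + a * n%:R + a * n%:R by rewrite /a; lra.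
rewrite !expRD -mulrA mulrCA -mulrA ler_pM2l ?expR_gt0//.
have nK : n%:R <= K * expR (a * n%:R).
  apply: le_trans (HK n); rewrite expr2 -natrM ler_nat.
  by rewrite mulSn (leq_trans (leqnSn n))// leq_addr.
have Ca : `|C| * K <= expR (a * n%:R).
  apply: le_trans (expR_ge1Dx _).
  have : `|C| * K <= a * n%:R.
    rewrite [leRHS]mulrC -ler_pdivrMr//; apply: ltW; apply: lt_le_trans (truncnS_gt _) _.
    by rewrite ler_nat.
  by lra.
apply: (@le_trans _ _ (`|C| * (K * expR (a * n%:R)))); first by rewrite ler_wpM2l.
by rewrite mulrA ler_wpM2r ?expR_ge0.
Qed.

End GrowthExponent.

(** * Covering the radial limit set by shadows *)

(** The blocks are laid end to end in one sequence; none of them is empty, so that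
the first [k] blocks have at least [k] terms. *)
Lemma concat_blocks (T : Type) (x0 : T) (L : nat -> seq T) :
  (forall n, (0 < size (L n))%N) -> forall n0,
  exists a : nat -> T, forall k,
    (k <= size (flatten (map L (iota n0 k))))%N /\
    mkseq a (size (flatten (map L (iota n0 k)))) = flatten (map L (iota n0 k)).
Proof.
move=> L0 n0; pose F k := flatten (map L (iota n0 k)).
have FS k l : exists s, F (k + l)%N = F k ++ s.
  by rewrite /F iotaD map_cat flatten_cat; eexists.
have size_F k : (k <= size (F k))%N.
  elim: k => // k IH; rewrite /F -addn1 iotaD map_cat flatten_cat size_cat.
  by rewrite leq_add//= cats0.
exists (fun i => nth x0 (F i.+1) i) => k; rewrite -/(F k).
split=> //; apply: (@eq_from_nth _ x0); rewrite size_mkseq// => i ik.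
rewrite nth_mkseq//; have [s Es] := FS k i.+1; have [s' Es'] := FS i.+1 k.
have := congr1 (fun t => nth x0 t i) Es'; rewrite addnC Es !nth_cat ik.
by rewrite (leq_trans _ (size_F i.+1)).
Qed.

Lemma expR_small (R : realType) (a c : R) : 0 < a -> 0 < c ->
  exists N, forall n, (N <= n)%N -> expR (- (a * n%:R)) <= c.
Proof.
move=> a0 c0; exists (Num.truncn (`|ln c| / a)).+1 => n Nn.
rewrite -[leRHS]lnK ?posrE// ler_expR.
have : `|ln c| <= a * n%:R.
  rewrite mulrC -ler_pdivrMr//; apply: ltW; apply: lt_le_trans (truncnS_gt _) _.
  by rewrite ler_nat.
have := ler_norm (- ln c); rewrite normrN; lra.
Qed.

Lemma geometric_sum_le (R : realType) (q : R) n0 k : 0 <= q -> q < 1 ->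
  \sum_(n <- iota n0 k) q ^+ n <= q ^+ n0 / (1 - q).
Proof.
move=> q0 q1; rewrite ler_pdivlMr; last by lra.
suff -> : (\sum_(n <- iota n0 k) q ^+ n) * (1 - q) = q ^+ n0 - q ^+ (n0 + k).
  by rewrite gerBl exprn_ge0.
elim: k => [|k IH]; first by rewrite big_nil mul0r addn0 subrr.
rewrite -addn1 iotaD big_cat /= big_seq1 mulrDl {}IH addnA addn1 exprS.
by lra.
Qed.

Section Upper.
Context {R : realType} {X : metricType R} (o : X) (delta : R).

Lemma maximal_separated (A : set X) : exists S, [/\ S `<=` A, separated S &
  forall x, A x -> exists2 y, S y & mdist x y <= 1].
Proof.
pose P (S : set X) := S `<=` A /\ forall x y, S x -> S y -> x <> y -> 1 < mdist x y.
have [F FP totF|S [[SA Ssep] maxS]] := @Zorn_bigcup X P.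
  split; first by move=> x [S FS Sx]; exact: (proj1 (FP _ FS)).
  move=> x y [S FS Sx] [S' FS' S'y] xy.
  have [SS'|S'S] := totF _ _ FS FS'.
    by apply: (proj2 (FP _ FS')) => //; exact: SS'.
  by apply: (proj2 (FP _ FS)) => //; exact: S'S.
exists S; split=> //; first by exists 1.
move=> x Ax; apply: contrapT => nx.
have far y : S y -> 1 < mdist x y.
  by move=> Sy; rewrite ltNge; apply/negP => xy; apply: nx; exists y.
apply: (maxS (x |` S)).
  split; first by move=> y Sy; right.
  move=> /(_ x (or_introl erefl)) Sx.
  by have := far _ Sx; rewrite mdistxx ltr10.
split; first by move=> y [->|/SA].
move=> y z [->|Sy] [->|Sz] yz //; [exact: far| |exact: Ssep].
by rewrite metric_sym; exact: far.
Qed.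

(** A sub-quasi-geodesic need not pass through the base point, but once its
Gromov products are large its first point cannot lie between two others, so
that far points lie between the first point and still farther ones. *)
Lemma radial_agree u : convergent o u -> sub_quasi_geodesic (range u) ->
  exists C N, forall i, (N <= i)%N -> agree o (fun=> u i) u (mdist (u i) o - C).
Proof.
move=> cu [C HC]; pose p := u 0%N; pose rp := mdist p o.
have rp0 : 0 <= rp by exact: mdist_ge0.
have /asymptoticP/(_ (C / 2 + rp))[N HN] := cu.
exists (rp + C / 2 + 1), N => i Ni.
have [M HM] := convergent_dist (2 * (mdist (u i) o + rp)) cu.
exists (maxn N M) => _ j _; rewrite geq_max => /andP[Nj Mj].
have uj := HM _ Mj; have ij := HN _ _ Ni Nj.
have ui0 := mdist_ge0 (u i) o.
have t1 := metric_triangle (u i) o p; have t2 := metric_triangle (u j) (u i) o.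
have t3 := metric_triangle (u j) p o; have t4 := metric_triangle (u i) p o.
rewrite (metric_sym o p) -/rp in t1 t3 t4.
rewrite (metric_sym (u j) (u i)) in t2.
have [ijp|pij] := lerP (mdist (u i) (u j)) (mdist p (u j)).
  have := HC p (u i) (u j); rewrite ge_max ijp andbT.
  have -> : mdist p (u i) <= mdist p (u j).
    by rewrite (metric_sym p (u i)) (metric_sym p (u j)); lra.
  move=> /(_ (imageT _ _) (imageT _ _) (imageT _ _) isT).
  rewrite (metric_sym p (u i)) (metric_sym p (u j)) => H.
  have := metric_triangle (u j) o p; rewrite (metric_sym o p) -/rp.
  by rewrite /gromov_product; lra.
have := HC (u i) p (u j); rewrite ge_max (ltW pij) andbT.
have -> : mdist (u i) p <= mdist (u i) (u j) by lra.
move=> /(_ (imageT _ _) (imageT _ _) (imageT _ _) isT) H.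
have base := gromov_product_base o p (u i) (u j).
rewrite (metric_sym o p) -/rp in base; exfalso.
by rewrite {2}/gromov_product (metric_sym (u j) p) in base; lra.
Qed.

Hypothesis hyp : hyperbolic_with o delta.

(** The boundary points that the point [x] approximates up to a proportion [k]
of its distance to the base point. *)
Definition shadow k x : set (boundary o) :=
  [set xi | exists2 v, val xi v & agree o (fun=> x) v (k * mdist x o)].

Lemma shadow_visual_ball k x xi n : 0 <= k -> n%:R <= mdist x o ->
  shadow k x xi ->
  shadow k x `<=` visual_ball xi (expR (delta + 1 - k * n%:R)).
Proof.
move=> k0 nx [v xv av] eta [w ew aw]; rewrite /visual_ball /= expRK opprB.
have := gromov_product_bar_ge xv ew (agree_trans hyp (agreeC av) aw).
apply: lt_le_trans; rewrite lte_fin.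
have : k * n%:R <= k * mdist x o by rewrite ler_wpM2l.
lra.
Qed.

Lemma radial_shadow (Gamma : set (X -> X)) (S : set X) k xi n0 :
  k < 1 -> (forall x, orbit_of Gamma o x -> exists2 y, S y & mdist x y <= 1) ->
  radial_limit_set o Gamma xi ->
  exists x, [/\ S x, n0%:R <= mdist x o & shadow k x xi].
Proof.
move=> k1 Snet [u [uG xu qu]]; have cu := boundary_convergent xu.
have [C [N HN]] := radial_agree cu qu.
have [M HM] := convergent_dist (n0%:R + 1 + 1 + (`|C| + 2) / (1 - k)) cu.
have {HM}[i Ni ui] : exists2 i, (N <= i)%N &
    n0%:R + 1 + 1 + (`|C| + 2) / (1 - k) < mdist (u i) o.
  by exists (maxn N M); [exact: leq_maxl|apply: HM; exact: leq_maxr].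
have [x Sx ux] := Snet _ (uG i).
have k10 : 0 < 1 - k by lra.
have frac0 : 0 <= (`|C| + 2) / (1 - k).
  by rewrite divr_ge0 ?ltW// ltr_wpDl.
have t1 := metric_triangle (u i) x o.
have t2 := metric_triangle x (u i) o; rewrite (metric_sym x (u i)) in t2.
exists x; split=> //; first by lra.
exists u => //; have [j Hj] := HN i Ni.
exists j => a b ja jb; have := Hj a b ja jb.
have := gromov_product_lip o x (u i) (u b); rewrite (metric_sym x (u i)).
have : (`|C| + 2) / (1 - k) <= mdist x o by have := ler0n R n0; lra.
rewrite ler_pdivrMr// => kx; have := ler_norm C.
by lra.
Qed.

(** Shadows with a loss proportional to the length, rather than bounded, absorb the
constants of all sub-quasi-geodesics: one family of balls covers the whole
radial limit set.  The proportion [1 - k] is small enough for the series to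
converge, its terms having exponent [s * k > s1]. *)
Lemma radial_null (Gamma : set (X -> X)) (S : set X) s1 s N0 (xi0 : boundary o) :
  0 <= s1 -> s1 < s ->
  (forall x, orbit_of Gamma o x -> exists2 y, S y & mdist x y <= 1) ->
  (forall n, (N0 <= n)%N -> (0 < n)%N ->
     (counting (ball o n%:R `&` S) <= (expR (s1 * n%:R))%:E)%E) ->
  visual_measure s (radial_limit_set o Gamma) = 0%E.
Proof.
move=> s10 s1s Snet Scount; apply: visual_measure0 => e c e0 c0.
have s0 : 0 < s by lra.
have [k [sk k0 k1]] : exists k, [/\ s * k = (s + s1) / 2, 0 < k & k < 1].
  exists ((s + s1) / 2 / s); rewrite mulrC divfK ?gt_eqF//; split=> //.
    by rewrite !divr_gt0//; lra.
  by rewrite ltr_pdivrMr//; lra.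
pose rad n := expR (delta + 1 - k * n%:R).
(* the additional point [o] makes every block nonempty; its ball has the same
   radius as those of its block *)
pose pts n : seq X := fset_set (S `&` annulus o n).
pose L n := map (pair n) (o :: pts n).
have L0 n : (0 < size (L n))%N by [].
pose a := (s - s1) / 2; have a0 : 0 < a by rewrite /a; lra.
pose q := expR (- a); have q0 : 0 <= q by exact: expR_ge0.
have q1 : q < 1 by rewrite -[ltRHS]expR0 ltr_expR; lra.
pose B := 2 * expR s1 * expR (s * (delta + 1)).
have B0 : 0 < B by rewrite !mulr_gt0 ?expR_gt0.
have cB0 : 0 < c * (1 - q) / B by rewrite divr_gt0// mulr_gt0//; lra.
have eB0 : 0 < e / expR (delta + 1) by rewrite divr_gt0// expR_gt0.
have [N1 HN1] := expR_small a0 cB0.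
have [N2 HN2] := expR_small k0 eB0.
pose n0 := maxn N0 (maxn N1 N2).
have n0N0 : (N0 <= n0)%N by rewrite leq_maxl.
have n0N1 : (N1 <= n0)%N by rewrite !leq_max leqnn !orbT.
have n0N2 : (N2 <= n0)%N by rewrite !leq_max leqnn !orbT.
have pts_fin n : (n0 <= n)%N -> finite_set (S `&` annulus o n).
  move=> nn; have := Scount n.+1 (leq_trans n0N0 (leqW nn)) isT.
  rewrite /counting; case: asboolP => // fin _; apply: sub_finite_set fin.
  move=> x [Sx /andP[_ xn]]; split=> //.
  by rewrite ballEmdist /= metric_sym.
have size_pts n : (n0 <= n)%N -> (size (pts n))%:R <= expR (s1 * n.+1%:R).
  move=> nn; apply: size_le_counting (Scount n.+1 (leq_trans n0N0 (leqW nn)) isT) _ _.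
    exact: fset_uniq.
  move=> x; rewrite in_fset_set; last exact: pts_fin.
  move=> /set_mem[Sx /andP[_ xn]]; split=> //.
  by rewrite ballEmdist /= metric_sym.
have block n : (n0 <= n)%N -> \sum_(z <- L n) rad z.1 `^ s <= B * q ^+ n.
  move=> nn; rewrite big_map (eq_bigr (fun=> rad n `^ s))// big_const_seq.
  rewrite count_predT iter_addr_0 -mulr_natr.
  rewrite /= -expRM.
  have le2 : (size (pts n)).+1%:R <= 2 * expR (s1 * n.+1%:R).
    have : 1 <= expR (s1 * n.+1%:R) by rewrite -[leLHS]expR0 ler_expR mulr_ge0.
    by have := size_pts _ nn; rewrite -natr1; lra.
  apply: le_trans (ler_wpM2l (expR_ge0 _) le2) _.
  rewrite /B /q -expRM_natl mulrCA -!mulrA ler_pM2l// -!expRD ler_expR.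
  rewrite -[n.+1%:R]natr1 /a.
  have : s * k * n%:R = (s + s1) / 2 * n%:R by rewrite sk.
  by lra.
have [item itemP] := concat_blocks (n0, o) L0 n0.
have item_ge i : (n0 <= (item i).1)%N.
  have [iF FE] := itemP i.+1; set F := flatten _ in iF FE.
  have i_iota : i \in iota 0 (size F) by rewrite mem_iota.
  have := map_f item i_iota; rewrite [map _ _]FE => /flattenP[_ /mapP[n + ->] /mapP[x _ ->]].
  by rewrite mem_iota => /andP[].
have : forall z : nat * X, exists xi : boundary o,
    forall eta, shadow k z.2 eta -> shadow k z.2 xi.
  move=> z; have [[eta He]|none] := pselect (exists eta, shadow k z.2 eta).
    by exists eta.
  by exists xi0 => eta He; case: none; exists eta.
move=> /choice[center centerP].
apply: (@le_trans _ _ (\sum_(0 <= i <oo) (rad (item i).1 `^ s)%:E)%E).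
  apply: ereal_inf_lbound; exists (fun i => center (item i)), (fun i => rad (item i).1).
  split=> //.
    move=> i; rewrite expR_gt0 /= /rad expRD.
    have := HN2 _ (leq_trans n0N2 (item_ge i)).
    by rewrite ler_pdivlMr ?expR_gt0// mulrC.
  move=> xi rxi; have [x [Sx nx xxi]] := radial_shadow n0 k1 Snet rxi.
  pose n := Num.truncn (mdist x o).
  have nn : (n0 <= n)%N by rewrite /n truncn_ge_nat ?mdist_ge0.
  have [_ FE] := itemP (n - n0).+1.
  have : (n, x) \in mkseq item (size (flatten (map L (iota n0 (n - n0).+1)))).
    rewrite FE; apply/flattenP; exists (L n).
      by apply: map_f; rewrite mem_iota nn addnS subnKC/=.
    rewrite map_f// inE; apply/orP; right.
    rewrite in_fset_set; last exact: pts_fin.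
    by apply/mem_set; split=> //; rewrite /annulus truncn_le mdist_ge0 truncnS_gt.
  move=> /mapP[i _ itemE]; exists i => //; rewrite -itemE /=.
  apply: (@shadow_visual_ball k x _ n _ _ _ xi) => //; first exact: ltW.
    by rewrite truncn_le mdist_ge0.
  exact: (centerP (n, x) _ xxi).
apply: lime_le; first by apply: is_cvg_nneseries => *; rewrite lee_fin powR_ge0.
apply: nearW => m; rewrite sumEFin lee_fin.
have [mF FE] := itemP m; set F := flatten _ in mF FE.
apply: (@le_trans _ _ (\sum_(z <- F) rad z.1 `^ s)).
  rewrite -FE big_map -[size F]subn0 -/(index_iota 0 _) (big_cat_nat _ mF)//=.
  by rewrite lerDl sumr_ge0// => *; exact: powR_ge0.
rewrite big_flatten big_map.
apply: (@le_trans _ _ (\sum_(n <- iota n0 m) B * q ^+ n)).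
  rewrite !big_seq; apply: ler_sum => n; rewrite mem_iota => /andP[nn _].
  exact: block.
rewrite -mulr_sumr.
apply: le_trans (ler_wpM2l (ltW B0) (geometric_sum_le n0 m q0 q1)) _.
have := HN1 _ n0N1; rewrite ler_pdivlMr// /q -expRM_natl mulrN (mulrC a).
rewrite [_ * B]mulrC => H; rewrite mulrA ler_pdivrMr//.
by rewrite subr_gt0.
Qed.

End Upper.

(** * Entropy and visual dimension *)

Section Entropy.
Context {R : realType} {X : metricType R} (o : X).
Implicit Types (A S : set X) (s : R).

Lemma growth_exponent_ge0 A x : A x -> (0 <= growth_exponent o A)%E.
Proof.
move=> Ax; rewrite leNgt; apply/negP => /ereal_inf_lt[_ [V [N _ NV] <-]].
apply/negP; rewrite -leNgt.
pose n := maxn N (Num.truncn (mdist x o)).+1.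
apply: le_trans (ereal_sup_ubound _); last first.
  by exists n => //; apply: NV; exact: leq_maxl.
apply: mule_ge0; first by rewrite lee_fin invr_ge0.
rewrite lne_ge0 /counting; case: asboolP => [fin|_]; last by rewrite leey.
rewrite lee_fin ler1n cardfs_gt0; apply/fset0Pn; exists x.
rewrite in_fset_set//; apply/mem_set; split=> //.
rewrite ballEmdist /= metric_sym; apply: lt_le_trans (truncnS_gt _) _.
by rewrite ler_nat leq_maxr.
Qed.

Lemma entropy_ge S A : A !=set0 -> separated S ->
  (growth_exponent o (A `&` S) <= entropy o A)%E.
Proof.
move=> /set0P A0 Ssep; rewrite /entropy (negbTE A0).
by apply: ereal_sup_ubound; exists S.
Qed.

Lemma entropy_gt s A : A !=set0 -> (s%:E < entropy o A)%E ->
  exists S t, [/\ separated S, s < t & (t%:E < growth_exponent o (A `&` S))%E].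
Proof.
move=> /set0P A0; rewrite /entropy (negbTE A0) => /ereal_sup_gt[_ [S Ssep <-]].
case E : (growth_exponent _ _) => [r| |//].
  rewrite lte_fin => sr; exists S, ((s + r) / 2); rewrite E lte_fin.
  by split=> //; lra.
by move=> _; exists S, (s + 1); rewrite E ltry; split=> //; lra.
Qed.

End Entropy.

Section Main.
Context {R : realType} {X : metricType R} (o : X) (Gamma : set (X -> X)).
Context (delta : R) (xi eta : boundary o).

Lemma visual_dimension_le_entropy :
  hyperbolic_with o delta -> limit_set o Gamma xi ->
  (visual_dimension (radial_limit_set o Gamma) <=
   entropy o (orbit_of Gamma o))%E.
Proof.
move=> hyp [u uG _]; have orb0 : orbit_of Gamma o !=set0 by exists (u 0%N).
have [S [SG Ssep Snet]] := maximal_separated (orbit_of Gamma o).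
have [y Sy _] := Snet _ (uG 0%N).
have := entropy_ge o orb0 Ssep; rewrite setIidr//.
have := growth_exponent_ge0 o Sy.
case: (entropy _ _) => [r| |]; last 2 first.
- by move=> _ _; exact: leey.
- by move=> g0 /(le_trans g0); rewrite leeNy_eq.
move=> g0 gr; have r0 : 0 <= r by rewrite -lee_fin (le_trans g0).
apply/lee_addgt0Pr => e e0; rewrite -EFinD.
apply: ereal_inf_lbound; exists (r + e) => //=; split; first by rewrite addr_ge0// ltW.
have growth_lt : (growth_exponent o S < (r + e / 2)%:E)%E.
  by apply: le_lt_trans gr _; rewrite lte_fin; lra.
have [N HN] := growth_exponent_lt growth_lt.
by apply: (radial_null hyp xi _ _ Snet HN); lra.
Qed.

Lemma entropy_le_visual_dimension :
  0 <= delta -> hyperbolic_with o delta -> proper_space X ->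
  compact (boundary_set o) -> isometry_semigroup Gamma ->
  limit_set o Gamma xi -> limit_set o Gamma eta -> xi <> eta ->
  (entropy o (orbit_of Gamma o) <=
   visual_dimension (radial_limit_set o Gamma))%E.
Proof.
move=> d0 hyp prop cpt GammaS xiL etaL xieta.
apply: le_ereal_inf_tmp => _ [s [s0 null] <-].
rewrite leNgt; apply/negP => s_lt; move: null; rewrite -/(~ _).
have orb0 : orbit_of Gamma o !=set0 by case: xiL => u uG _; exists (u 0%N).
have [S [t [[e e0 Se] st tS]]] := entropy_gt orb0 s_lt.
pose P := orbit_of Gamma o `&` S.
have Pe x y : P x -> P y -> x <> y -> e < mdist x y.
  by move=> [_ Sx] [_ Sy]; exact: Se.
have : forall x, exists g : (X -> X) * (X -> X), P x ->
    [/\ Gamma g.1, g.1 o = x, cancel g.1 g.2 & cancel g.2 g.1].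
  move=> x; case: (pselect (P x)) => [[[g Gg gx] _]|nP]; last by exists (id, id).
  have [h [_ gK hK]] := isometry_inv (proj1 GammaS _ Gg).
  by exists (g, h).
move=> /choice[G GP].
have nsparse : ~ sparse o ((s + t) / 2) P.
  move=> sp; have : (growth_exponent o P <= t%:E)%E.
    by apply: (sparse_growth_exponent _ _ sp); lra.
  by rewrite leNgt tS.
apply: (ample_visual_measure d0 hyp GammaS s0).
apply: (@growth_ample _ _ _ _ d0 hyp prop cpt _ GammaS P e
  (fun x => (G x).1) (fun x => (G x).2) e0 Pe _ _ _ _ s ((s + t) / 2) xi eta) => //.
- by move=> x /GP[].
- by move=> x /GP[].
- by move=> x /GP[].
- by move=> x /GP[].
- by lra.
Qed.

End Main.

Theorem mainTheorem2 (R : realType) (X : metricType R) (o : X)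
    (Gamma : set (X -> X)) :
  proper_space X ->
  gromov_hyperbolic o ->
  compact (boundary_set o) ->
  isometry_semigroup Gamma ->
  (exists xi eta : boundary o,
    [/\ limit_set o Gamma xi, limit_set o Gamma eta & xi <> eta]) ->
  visual_dimension (radial_limit_set o Gamma) = entropy o (orbit_of Gamma o).
Proof.
move=> prop [delta d0 hyp] cpt GammaS [xi [eta [xiL etaL xieta]]].
apply/eqP; rewrite eq_le (visual_dimension_le_entropy hyp xiL).
exact: entropy_le_visual_dimension d0 hyp prop cpt GammaS xiL etaL xieta.
Qed.
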